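(* The classes $[Y_G]$ of the affine graph hypersurface complements, as $G$ ranges over all finite graphs, do not span the Grothendieck ring $K(\mathrm{Var})$ as a module over $\mathbb{Z}[\mathbb{L}]$, where $\mathbb{L}=[\mathbb{A}^1]$.
   Context: Graphs are finite; looping edges and multiple edges are allowed, and graphs need not be connected. For a connected graph $G$ with edges $e_1,\dots,e_n$ and corresponding variables $t_1,\dots,t_n$, the graph polynomial is $\psi_G(t_1,\dots,t_n)=\sum_{T\subseteq G}\prod_{e\notin T}t_e$, where $T$ runs over the spanning trees of $G$ and $t_e$ is the variable of the edge $e$. For a general finite graph, $\psi_G$ is the product of the graph polynomials of its connected components. Let $\widehat X_G\subset\mathbb{A}^n$ be the affine hypersurface $\{\psi_G=0\}$ and $Y_G=\mathbb{A}^n\smallsetminus\widehat X_G$ the affine graph hypersurface complement. $K(\mathrm{Var})$ is the Grothendieck ring of varieties over $\mathbb{Q}$: it is generated by isomorphism classes of quasi-projective varieties, with relations $[X]=[X\smallsetminus Y]+[Y]$ for closed embeddings $Y\subseteq X$ and product $[X]\cdot[Y]=[X\times Y]$. It is regarded as a module over $\mathbb{Z}[\mathbb{L}]$ via multiplication by $\mathbb{L}=[\mathbb{A}^1]$. *)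

(* Defs.v *)
From HB Require Import structures.
From mathcomp Require Import all_boot all_order all_algebra all_field.
From mathcomp Require Import boolp.
From mathcomp Require monalg mpoly.

Set Implicit Arguments.
Unset Strict Implicit.
Unset Printing Implicit Defensive.

Import GRing.Theory.

Local Open Scope ring_scope.
Local Open Scope quotient_scope.

(* The free commutative ring on a type of generators. The module confines the
   notations of monalg, which overlap with those of mpoly. *)
Module FreeComRing.
Import monalg.

Definition ring (I : choiceType) : comNzRingType := {malg int[{cmonom I}]}.
Definition gen (I : choiceType) (i : I) : ring I := << ucm i >>.

End FreeComRing.

Import mpoly.

(* Quotient of a commutative ring by the ideal generated by P. The quotient
   [ideal_quot] of MathComp is only available for proper ideals; here the
   ideal is arbitrary, so the quotient is a possibly zero ring. *)
Section IdealQuotient.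
Variables (R : comNzRingType) (P : R -> Prop).

Inductive ideal_gen : R -> Prop :=
| ideal_gen_base x : P x -> ideal_gen x
| ideal_gen0 : ideal_gen 0
| ideal_genD x y : ideal_gen x -> ideal_gen y -> ideal_gen (x + y)
| ideal_genM a x : ideal_gen x -> ideal_gen (a * x).

Definition in_ideal : {pred R} := fun x => `[< ideal_gen x >].

Lemma in_ideal_zmod_closed : zmod_closed in_ideal.
Proof.
split=> [|x y /asboolP hx /asboolP hy]; apply/asboolP; first exact: ideal_gen0.
by apply: ideal_genD => //; rewrite -mulN1r; apply: ideal_genM.
Qed.

HB.instance Definition _ := GRing.isZmodClosed.Build R in_ideal in_ideal_zmod_closed.

Definition gen_quot := Quotient.quot in_ideal.

HB.instance Definition _ := GRing.Zmodule.on gen_quot.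

Definition gen_pi : R -> gen_quot := \pi_(Quotient.quot in_ideal).
Definition gen_repr : gen_quot -> R := @repr _ (Quotient.quot in_ideal).
Definition gen_one : gen_quot := gen_pi 1.
Definition gen_mul (x y : gen_quot) : gen_quot := gen_pi (gen_repr x * gen_repr y).

Lemma gen_reprK : cancel gen_repr gen_pi.
Proof. exact: reprK. Qed.

Lemma gen_piP x y : reflect (gen_pi x = gen_pi y) (x - y \in in_ideal).
Proof. by rewrite Quotient.idealrBE; apply: eqP. Qed.

Lemma gen_piD : {morph gen_pi : x y / x + y}.
Proof. by move=> x y; rewrite /gen_pi raddfD. Qed.

Lemma gen_piM : {morph gen_pi : x y / x * y >-> gen_mul x y}.
Proof.
have mul a z : z \in in_ideal -> a * z \in in_ideal.
  by move=> /asboolP hz; apply/asboolP; apply: ideal_genM.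
have sub z : z - gen_repr (gen_pi z) \in in_ideal.
  by apply/gen_piP; rewrite gen_reprK.
move=> x y; apply/gen_piP; set x' := gen_repr _; set y' := gen_repr _.
have -> : x * y - x' * y' = x * (y - y') + y' * (x - x').
  by rewrite !mulrBr [y' * x]mulrC [y' * x']mulrC addrA subrK.
by rewrite rpredD ?mul ?sub.
Qed.

Lemma gen_mulA : associative gen_mul.
Proof.
by move=> x y z; rewrite -[x]gen_reprK -[y]gen_reprK -[z]gen_reprK -!gen_piM mulrA.
Qed.

Lemma gen_mulC : commutative gen_mul.
Proof. by move=> x y; rewrite /gen_mul mulrC. Qed.

Lemma gen_mul1 : left_id gen_one gen_mul.
Proof. by move=> x; rewrite -[x]gen_reprK -gen_piM mul1r. Qed.

Lemma gen_mulDl : left_distributive gen_mul +%R.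
Proof.
move=> x y z; rewrite -[x]gen_reprK -[y]gen_reprK -[z]gen_reprK.
by rewrite -gen_piD -!gen_piM mulrDl gen_piD.
Qed.

HB.instance Definition _ := GRing.Zmodule_isComPzRing.Build gen_quot
  gen_mulA gen_mulC gen_mul1 gen_mulDl.

End IdealQuotient.

(* A quasi-projective variety over rat in the projective space with N
   homogeneous coordinates: the locus where all the forms in [qp_eqs] and not
   all the forms in [qp_neqs] vanish. *)
Definition qpvar N :=
  {FG : seq {mpoly rat[N]} * seq {mpoly rat[N]}
      | all (fun p => p \is homog mdeg) (FG.1 ++ FG.2)}.
Definition qp_eqs N (X : qpvar N) := (val X).1.
Definition qp_neqs N (X : qpvar N) := (val X).2.

Definition qeval N (p : {mpoly rat[N]}) (v : 'rV[algC]_N) : algC :=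
  (map_mpoly ratr p).@[v ord0].

Definition vanish N (s : seq {mpoly rat[N]}) (v : 'rV[algC]_N) : bool :=
  all (fun p => qeval p v == 0) s.

(* A variety over rat is handled through its points over the algebraic closure
   algC of rat: [qp_pt X v] says that v is a vector of homogeneous coordinates
   of a point of X. *)
Definition qp_pt N (X : qpvar N) (v : 'rV[algC]_N) : bool :=
  [&& v != 0, vanish (qp_eqs X) v & ~~ vanish (qp_neqs X) v].

Definition same_pt N (u v : 'rV[algC]_N) : Prop :=
  exists2 c : algC, c != 0 & u = c *: v.

Definition formmap N M (h : 'I_M -> {mpoly rat[N]}) (v : 'rV[algC]_N) :
  'rV[algC]_M := \row_j qeval (h j) v.

(* Regular maps over rat: around each point, the map is given by forms of the
   same degree with rational coefficients, on the open set where these do not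
   all vanish. Forms that represent the map on a smaller neighbourhood only are
   brought to this shape by multiplying them by a form that vanishes on its
   complement in X. The last clause makes f compatible with [same_pt] on X. *)
Definition regular_map N M (X : qpvar N) (Y : qpvar M)
    (f : 'rV[algC]_N -> 'rV[algC]_M) : Prop :=
  (forall v, qp_pt X v -> qp_pt Y (f v)) /\
  (forall v, qp_pt X v -> exists (d : nat) (h : 'I_M -> {mpoly rat[N]}),
    [/\ forall j, h j \is d.-homog,
        formmap h v != 0
      & forall w, qp_pt X w -> formmap h w != 0 -> same_pt (f w) (formmap h w)]).

Definition qp_iso N M (X : qpvar N) (Y : qpvar M) : Prop :=
  exists (f : 'rV[algC]_N -> 'rV[algC]_M) (g : 'rV[algC]_M -> 'rV[algC]_N),
    [/\ regular_map X Y f, regular_map Y X g,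
        forall v, qp_pt X v -> same_pt (g (f v)) v
      & forall w, qp_pt Y w -> same_pt (f (g w)) w].

Definition closed_in N (Y X : qpvar N) : Prop :=
  exists2 H : seq {mpoly rat[N]}, all (fun p => p \is homog mdeg) H
    & forall v, qp_pt Y v = qp_pt X v && vanish H v.

Definition complement_of N (U X Y : qpvar N) : Prop :=
  forall v, qp_pt U v = qp_pt X v && ~~ qp_pt Y v.

(* Z is the image of X x Y under the Segre embedding. *)
Definition segre_product N M (X : qpvar N) (Y : qpvar M) (Z : qpvar (N * M)%N) :
    Prop :=
  forall z, qp_pt Z z <->
    exists (x : 'rV[algC]_N) (y : 'rV[algC]_M),
      [/\ qp_pt X x, qp_pt Y y & z = mxvec (x^T *m y)].

(* Homogenization with respect to the added coordinate 'X_ord0. *)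
Definition homogenize n (p : {mpoly rat[n]}) : {mpoly rat[n.+1]} :=
  \sum_(m <- msupp p)
    p@_m *: ('X_ord0 ^+ ((msize p).-1 - mdeg m)
             * \prod_(i < n) 'X_(lift ord0 i) ^+ m i).

Lemma homogenize_homog n (p : {mpoly rat[n]}) :
  homogenize p \is (msize p).-1.-homog.
Proof.
rewrite /homogenize big_seq; apply: rpred_sum => m hm0; apply: rpredZ.
have le : (mdeg m <= (msize p).-1)%N.
  by have := msize_mdeg_lt hm0; case: (msize p).
have hX k (i : 'I_n.+1) : ('X_i ^+ k : {mpoly rat[n.+1]}) \is k.-homog.
  have h1 : ('X_i : {mpoly rat[n.+1]}) \is 1.-homog by rewrite dhomogX /= mdeg1.
  by move: (dhomogMn k h1); rewrite mul1n.
pose dg (r : seq 'I_n) := (\sum_(i <- r) m i)%N.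
have hm (r : seq 'I_n) : \prod_(i <- r) 'X_(lift ord0 i) ^+ m i \is
    [in rat[n.+1], (dg r).-homog].
  rewrite /dg; elim: r => [|i r IH]; first by rewrite !big_nil; apply: dhomog1.
  by rewrite !big_cons; apply: dhomogM.
have := dhomogM (hX ((msize p).-1 - mdeg m)%N ord0) (hm (index_enum 'I_n)).
by rewrite /dg -mdegE subnK.
Qed.

(* The locally closed subset { F = 0 } minus { G = 0 } of the affine space of
   dimension n, where F and G are finite systems of polynomials, seen in the
   chart { 'X_ord0 != 0 } of the projective space of dimension n. *)
Definition affine_data n (F G : seq {mpoly rat[n]}) :=
  (map (@homogenize n) F, map (fun g => 'X_ord0 * homogenize g) G).

Lemma affine_data_homog n (F G : seq {mpoly rat[n]}) :
  all (fun p => p \is homog mdeg) ((affine_data F G).1 ++ (affine_data F G).2).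
Proof.
rewrite all_cat /= !all_map; apply/andP; split; apply/allP => p _ /=.
  exact: (homogE (homogenize_homog p)).
have hX : ('X_ord0 : {mpoly rat[n.+1]}) \is 1.-homog by rewrite dhomogX /= mdeg1.
exact: (homogE (dhomogM hX (homogenize_homog p))).
Qed.

Definition affine_var n (F G : seq {mpoly rat[n]}) : qpvar n.+1 :=
  exist _ (affine_data F G) (affine_data_homog F G).

Definition affine_space n : qpvar n.+1 := affine_var [::] [:: 1 : {mpoly rat[n]}].

Definition freeVar : comNzRingType := FreeComRing.ring {N : nat & qpvar N}.

Definition gen N (X : qpvar N) : freeVar :=
  FreeComRing.gen (existT qpvar N X).

(* Since 1 is the empty product of generators, it has to be identified with the
   class of the point. *)
Inductive KVar_rel : freeVar -> Prop :=
| KVar_iso N M (X : qpvar N) (Y : qpvar M) :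
    qp_iso X Y -> KVar_rel (gen X - gen Y)
| KVar_scissor N (X Y U : qpvar N) :
    closed_in Y X -> complement_of U X Y -> KVar_rel (gen X - (gen U + gen Y))
| KVar_prod N M (X : qpvar N) (Y : qpvar M) (Z : qpvar (N * M)%N) :
    segre_product X Y Z -> KVar_rel (gen X * gen Y - gen Z)
| KVar_unit : KVar_rel (gen (affine_space 0) - 1).

Definition KVar : comPzRingType := gen_quot KVar_rel.

Definition KVar_class N (X : qpvar N) : KVar := gen_pi KVar_rel (gen X).

Definition Lefschetz : KVar := KVar_class (affine_space 1).

Definition ZL_scale (p : {poly int}) (x : KVar) : KVar :=
  (\sum_(i < size p) Lefschetz ^+ i *~ p`_i) * x.

(* Finite graphs, with loops and multiple edges; the edges are numbered. The
   two ends of an edge are listed in an arbitrary order. *)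
Record graph := Graph {
  vertex : finType;
  nedge : nat;
  ends : 'I_nedge -> vertex * vertex }.

Section GraphPolynomial.
Variable G : graph.
Local Notation V := (vertex G).
Local Notation E := 'I_(nedge G).

Definition adj_in (T : {set E}) : rel V :=
  fun x y => [exists e in T, (ends e == (x, y)) || (ends e == (y, x))].

Definition dart := (E * bool)%type.
Definition dsrc (d : dart) : V := if d.2 then (ends d.1).2 else (ends d.1).1.
Definition dtgt (d : dart) : V := if d.2 then (ends d.1).1 else (ends d.1).2.

(* A cycle visits each of its edges and of its vertices once: a loop is a cycle
   of length 1, and two parallel edges form a cycle of length 2. *)
Definition graph_cycle (s : seq dart) : bool :=
  [&& (0 < size s)%N, cycle (fun d d' => dtgt d == dsrc d') s,
      uniq (map fst s) & uniq (map dsrc s)].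

(* A cycle has at most [nedge G] edges, so lengths can be bounded. *)
Definition acyclic (T : {set E}) : bool :=
  [forall k : 'I_(nedge G).+1, forall s : k.-tuple dart,
     all (fun d => d.1 \in T) s ==> ~~ graph_cycle s].

Definition components : {set {set V}} :=
  equivalence_partition (connect (adj_in [set: E])) [set: V].

Definition edges_of (C : {set V}) : {set E} := [set e | (ends e).1 \in C].

Definition spanning_tree (C : {set V}) (T : {set E}) : bool :=
  [&& T \subset edges_of C, [forall x in C, forall y in C, connect (adj_in T) x y]
    & acyclic T].

Definition component_poly (C : {set V}) : {mpoly rat[nedge G]} :=
  \sum_(T : {set E} | spanning_tree C T) \prod_(e in edges_of C :\: T) 'X_e.

Definition graph_poly : {mpoly rat[nedge G]} :=
  \prod_(C in components) component_poly C.

End GraphPolynomial.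

Definition graph_complement (G : graph) : qpvar (nedge G).+1 :=
  affine_var [::] [:: graph_poly G].

Definition in_graph_span (x : KVar) : Prop :=
  exists s : seq ({poly int} * graph),
    x = \sum_(a <- s) ZL_scale a.1 (KVar_class (graph_complement a.2)).

(* Main.v *)
(** Counting points over finite fields K gives a ring morphism mu_K from the
    free ring on the varieties to K, which sends a variety to its number of
    K-points modulo the characteristic. Each element of the ideal of relations
    is killed by mu_K for almost all K: a relation only involves identities
    between points over algC that are universal, and by the Nullstellensatz
    over Z such an identity is certified by polynomials with integer
    coefficients, hence survives the reduction modulo almost all primes.

    The Lefschetz class has q = 0 points modulo the characteristic. A graph
    polynomial is affine in each variable, and for fixed a and b the number of
    x in K with a + b x <> 0 is 0 modulo the characteristic if b = 0, and -1
    otherwise; eliminating the variables one by one, the number of points of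
    the complement is 0 or (-1)^n, where the case depends on the coefficient of
    the product of all n variables. So mu_K maps an element of the span to a
    constant integer for almost all K. For the variety x^2 + 1 = 0 this fails:
    it has no points over F_p if p = 3 mod 4, and a nonzero number of points
    modulo p if p divides (m!)^2 + 1. *)

Require Import Defs.
From HB Require Import structures.
From mathcomp Require Import all_boot all_order all_algebra all_field.
From mathcomp Require Import boolp.
From mathcomp Require classical_sets.
From mathcomp Require monalg mpoly finmap.

Set Implicit Arguments.
Unset Strict Implicit.
Unset Printing Implicit Defensive.

Import Order.TTheory GRing.Theory Num.Theory.

Local Open Scope ring_scope.
Local Open Scope quotient_scope.

(** * Morphisms from free commutative rings *)

Module FreeComRingMorphism.
Import finmap monalg.

Section Universal.
Variables (I : choiceType) (S : comNzRingType) (c : I -> S).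

Definition cmonom_eval (m : {cmonom I}) : S :=
  \prod_(i <- finsupp m) c i ^+ m i.

Lemma cmonom_evalEw (m : {cmonom I}) (d : {fset I}) : (finsupp m `<=` d)%fset ->
  cmonom_eval m = \prod_(i <- d) c i ^+ m i.
Proof.
move=> le; rewrite /cmonom_eval (big_fset_incl _ le) // => i _.
by rewrite -cmE_neq0 negbK => /eqP->; rewrite expr0.
Qed.

Fact cmonom_eval_morphism : mmorphism cmonom_eval.
Proof.
split=> [m1 m2|]; last by rewrite /cmonom_eval mdom1 big_seq_fset0.
rewrite /cmonom_eval mdomD -!/(cmonom_eval _).
rewrite (cmonom_evalEw (fsubsetUl _ (finsupp m2))).
rewrite (cmonom_evalEw (fsubsetUr (finsupp m1) _)) -big_split /=.
by apply: eq_bigr => i _; rewrite cmM exprD.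
Qed.

HB.instance Definition _ :=
  isMultiplicative.Build _ _ cmonom_eval cmonom_eval_morphism.

Definition extend : {rmorphism FreeComRing.ring I -> S} := mmap intr cmonom_eval.

Lemma extend_gen i : extend (FreeComRing.gen i) = c i.
Proof. by rewrite /extend /= mmapU mul1r /cmonom_eval mdomU big_seq_fset1 cmUU. Qed.

End Universal.
End FreeComRingMorphism.

(** * Extension of specializations *)

Section Extension.
Variables (A K : idomainType) (phi : {rmorphism A -> K}).
Implicit Types f g m e : {poly A}.
Local Notation "f ^phi" := (map_poly phi f) (at level 2, format "f ^phi").

(** The dropped coefficients lie in the kernel of [phi], so the image is unchanged while the size
    becomes that of the image. *)
Definition trunc f : {poly A} := \poly_(i < size f^phi) f`_i.

Lemma map_trunc f : (trunc f)^phi = f^phi.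
Proof.
apply/polyP => i; rewrite !coef_map coef_poly; case: ltnP => // le.
by rewrite raddf0 -coef_map nth_default.
Qed.

Lemma size_trunc f : size (trunc f) = size f^phi.
Proof.
apply/eqP; rewrite eqn_leq size_poly /= -map_trunc map_polyE.
exact: leq_trans (size_Poly _) (eq_leq (size_map _ _)).
Qed.

(** A property that depends only on images is stable under [trunc], so an element of minimal size
    keeps its size under [phi]. *)
Lemma min_size_poly (P : {poly A} -> Prop) m0 :
    (forall m m', m^phi = m'^phi -> P m -> P m') -> P m0 ->
  exists m, [/\ P m, size m = size m^phi
              & forall m', P m' -> (size m <= size m')%N].
Proof.
move=> ext Pm0; pose Q n := `[< exists2 m, P m & size m = n >].
have exQ : exists n, Q n by exists (size m0); apply/asboolP; exists m0.
case: (ex_minnP exQ) => n /asboolP[m Pm szm] min.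
have mini m' : P m' -> (size m <= size m')%N.
  by move=> Pm'; rewrite szm; apply: min; apply/asboolP; exists m'.
exists m; split=> //; apply/eqP; rewrite eqn_leq -{1}size_trunc mini /=.
  by rewrite map_polyE; apply: leq_trans (size_Poly _) (eq_leq (size_map _ _)).
by apply: ext Pm; rewrite map_trunc.
Qed.

Lemma map_lead_neq0 m : size m = size m^phi -> m^phi != 0 ->
  phi (lead_coef m) != 0.
Proof. by move=> szm nz; rewrite /lead_coef szm -coef_map lead_coef_eq0. Qed.

Lemma divp_expn f m : exists k,
  lead_coef m ^+ k *: f = (f %/ m)%R * m + (f %% m)%R.
Proof. by exists (scalp f m); apply: Pdiv.Idomain.divp_eq. Qed.

(* If b is transcendental over phi A, then c only has to avoid the roots of g.
   Otherwise let m be a relation for b of minimal size. By pseudo-division the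
   roots of psi m satisfy all relations for b. A nonzero combination e of g and m
   of minimal size divides m, so it is constant by minimality of m, and hence g
   does not vanish at these roots. *)
Lemma extend_specialization (Omega : closedFieldType) (b : K) g :
    (g^phi).[b] != 0 ->
  exists2 a, phi a != 0 & forall psi : {rmorphism A -> Omega},
    (forall x, phi x = 0 -> psi x = 0) -> psi a != 0 ->
  exists c, (forall f, (f^phi).[b] = 0 -> (map_poly psi f).[c] = 0)
            /\ (map_poly psi g).[c] != 0.
Proof.
move=> gb.
have g_neq0 : g^phi != 0 by apply: contraNneq gb => ->; rewrite horner0.
have spec0 (psi : {rmorphism A -> Omega}) :
    (forall x, phi x = 0 -> psi x = 0) ->
  forall f, f^phi = 0 -> map_poly psi f = 0.
  move=> ker f f0; apply/polyP => i; rewrite coef_map coef0 /= ker //.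
  by rewrite -coef_map f0 coef0.
have [[m0 [m0_neq0 m0b]]|noeq] :=
    pselect (exists m, m^phi != 0 /\ (m^phi).[b] = 0); last first.
  (* In the transcendental case it suffices that the coefficient of [g] lying over the leading
     coefficient of [g^phi] survives [psi]: a nonzero polynomial over a closed field has a
     nonroot. *)
  exists (g`_(size g^phi).-1); first by rewrite -coef_map lead_coef_eq0.
  move=> psi ker nz.
  have /closed_nonrootP[c /rootP gc] : map_poly psi g != 0.
    by apply: contraNneq nz => g0; rewrite -coef_map g0 coef0.
  exists c; split=> [f fb|]; last exact/eqP.
  rewrite (spec0 psi ker) ?horner0 //; apply/eqP/negPn/negP => nz'.
  by apply: noeq; exists f.
have [|m [[m_neq0 mb] szm minm]] := @min_size_poly
  (fun m => m^phi != 0 /\ (m^phi).[b] = 0) m0 _ (conj m0_neq0 m0b).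
  by move=> m m' ->.
have lm := map_lead_neq0 szm m_neq0.
have mnz : m != 0 by apply: contraNneq m_neq0 => ->; rewrite rmorph0.
(* Combinations are formed on images, but the multipliers are lifted to [A] so that the relation can
   be pushed along [psi]. *)
pose J e := e^phi != 0 /\ exists s t, e^phi = s^phi * g^phi + t^phi * m^phi.
have Jg : J g.
  by split=> //; exists 1, 0; rewrite rmorph0 mul0r addr0 rmorph1 mul1r.
have [|e [[e_neq0 [s [t def_e]]] sze mine]] := @min_size_poly J g _ Jg.
  by rewrite /J => u u' ->.
have le := map_lead_neq0 sze e_neq0.
have enz : e != 0 by apply: contraNneq e_neq0 => ->; rewrite rmorph0.
(* A pseudo-remainder modulo [e] is again a combination, of smaller size, so minimality of [e] makes
   its image vanish. *)
have rem0 f s' t' : f^phi = s'^phi * g^phi + t'^phi * m^phi ->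
    (f %% e)^phi = 0.
  move=> def_f; apply/eqP/negPn/negP => nz.
  suff /mine : J (f %% e) by rewrite leqNgt Pdiv.CommonIdomain.ltn_modp enz.
  split=> //; have [k /(congr1 (map_poly phi))] := divp_expn f e; set c := _ ^+ k.
  rewrite rmorphD rmorphM /= linearZ /= => /esym/(canRL (addKr _)) ->.
  exists (c%:P * s' - (f %/ e) * s), (c%:P * t' - (f %/ e) * t).
  rewrite !rmorphB !rmorphM /= map_polyC /= def_f def_e -mul_polyC.
  by rewrite !mulrDr !mulrDl !mulNr !mulrA opprD addrC addrACA.
have [kg /(congr1 (map_poly phi))] := divp_expn g e.
rewrite rmorphD rmorphM /= linearZ /=.
rewrite (rem0 g 1 0) ?rmorph0 ?mul0r ?addr0; last first.
  by rewrite rmorph1 mul1r.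
move=> def_g.
have [km /(congr1 (map_poly phi))] := divp_expn m e.
rewrite rmorphD rmorphM /= linearZ /=.
rewrite (rem0 m 0 1) ?rmorph0 ?mul0r ?add0r ?addr0; last first.
  by rewrite rmorph1 mul1r.
move=> def_m.
have eb : (e^phi).[b] != 0.
  apply: contraNneq gb => eb0; move/(congr1 (horner^~ b)): def_g.
  rewrite hornerZ hornerM eb0 mulr0 => /eqP.
  by rewrite rmorphXn mulf_eq0 expf_eq0 (negPf le) andbF.
have q_neq0 : (m %/ e)^phi != 0.
  apply: contraNneq m_neq0 => q0; move: def_m; rewrite q0 mul0r => /eqP.
  by rewrite -mul_polyC mulf_eq0 polyC_eq0 rmorphXn expf_eq0 (negPf le) andbF.
(* As [e^phi] does not vanish at [b], the quotient [m %/ e] does; by minimality it is no smaller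
   than [m], which leaves a constant for [e]. *)
have size_e : size e = 1%N.
  apply/eqP; rewrite eqn_leq size_poly_gt0 enz andbT.
  have := minm (trunc (m %/ e)); rewrite map_trunc size_trunc => /(_ _)/wrap[].
    split=> //; move/(congr1 (horner^~ b)): def_m.
    rewrite hornerZ hornerM mb mulr0 => /esym/eqP.
    by rewrite mulf_eq0 (negPf eb) orbF => /eqP.
  move/(congr1 (fun p : {poly K} => size p)): def_m.
  rewrite size_scale ?rmorphXn ?expf_neq0 // size_mul // -szm -sze => ->.
  by case: (size e) => // k; rewrite addnS /= -[leqRHS]addn0 leq_add2l.
have def_eC : e = (e`_0)%:P by apply: size1_polyC; rewrite size_e.
(* The first factor preserves the size of [m] under [psi], which provides the root [c]; the second
   keeps [e] nonzero, and [e = s g + t m] at [c] then forbids [g] to vanish. *)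
exists (lead_coef m * e`_0).
  by rewrite rmorphM mulf_neq0 //; move: le; rewrite /lead_coef size_e.
move=> psi ker; rewrite rmorphM mulf_eq0 negb_or => /andP[psim psie].
have size_psi : size (map_poly psi m) = size m.
  by rewrite size_map_poly_id0.
have /closed_rootP[c /rootP mc] : size (map_poly psi m) != 1%N.
  rewrite size_psi szm; apply: contra_not_neq (negP m_neq0) => /eqP/size_poly1P.
  by move=> [x x0 mx]; move: mb; rewrite mx hornerC => /eqP; rewrite (negPf x0).
exists c; split=> [f fb|].
  have [k /[dup]] := divp_expn f m.
  move=> /(congr1 (map_poly phi)) + /(congr1 (map_poly psi)).
  rewrite !rmorphD !rmorphM /= !linearZ /=.
  set r := map_poly phi (f %% m) => phi_f.
  have rb : r.[b] = 0.
    move/(congr1 (horner^~ b)): phi_f.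
    by rewrite hornerZ hornerD hornerM mb fb !mulr0 add0r.
  have -> : map_poly psi (f %% m) = 0.
    apply: spec0 => //; apply/eqP/negPn/negP => nz.
    by have /minm := conj nz rb; rewrite leqNgt Pdiv.CommonIdomain.ltn_modp mnz.
  move=> psi_f; move/(congr1 (horner^~ c)): psi_f.
  rewrite hornerZ addr0 hornerM mc mulr0 => /eqP.
  by rewrite rmorphXn mulf_eq0 expf_eq0 (negPf psim) andbF => /eqP.
have : map_poly psi (s * g + t * m - e) = 0.
  by apply: spec0; rewrite // rmorphB rmorphD !rmorphM /= def_e subrr.
rewrite rmorphB rmorphD !rmorphM /= => /(congr1 (horner^~ c))/eqP.
rewrite hornerD hornerN hornerD !hornerM mc mulr0 addr0 horner0 subr_eq0.
rewrite def_eC map_polyC hornerC => /eqP gc.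
by apply: contraNneq psie => g0; rewrite -gc g0 mulr0.
Qed.

End Extension.

(** * The Nullstellensatz over the integers *)

(** Iterated univariate polynomials, the last variable outermost, so that the variables can be
    specialized one at a time. *)
Fixpoint zpoly n : idomainType := if n is n'.+1 then {poly zpoly n'} else int.

Fixpoint zeval (R : comNzRingType) (v : nat -> R) n : {rmorphism zpoly n -> R} :=
  match n with
  | 0 => intr
  | n'.+1 => horner_morph (fun x => mulrC (v n') (zeval v n' x))
  end.

Fixpoint zvar n (i : nat) : zpoly n :=
  match n with
  | 0 => 0
  | n'.+1 => if i == n' then 'X : {poly zpoly n'} else (zvar n' i)%:P
  end.

Lemma zevalS (R : comNzRingType) (v : nat -> R) n (f : zpoly n.+1) :
  zeval v n.+1 f = (map_poly (zeval v n) f).[v n].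
Proof. by []. Qed.

Lemma zeval_var (R : comNzRingType) (v : nat -> R) n i :
  (i < n)%N -> zeval v n (zvar n i) = v i.
Proof.
elim: n => // n IH; rewrite ltnS leq_eqVlt zevalS /=.
have [->|_ /= lt] := eqVneq i n; first by rewrite map_polyX hornerX.
by rewrite map_polyC hornerC /= IH.
Qed.

Lemma eq_zeval (R : comNzRingType) (v w : nat -> R) n f :
  (forall i, (i < n)%N -> v i = w i) -> zeval v n f = zeval w n f.
Proof.
elim: n f => [//|n IH] f eq_vw; rewrite !zevalS eq_vw //; congr _.[_].
by apply/polyP => i; rewrite !coef_map /=; apply: IH => j /leqW; apply: eq_vw.
Qed.

(** Each use of [extend_specialization] trades [g] for a nonzero element in one variable fewer. In
    the end only integers remain, and both fields of values have characteristic 0. *)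
Lemma zpoly_specialization (K : idomainType) (Omega : closedFieldType)
    (v : nat -> K) n (g : zpoly n) :
    (forall z : int, z%:~R = 0 :> K -> z = 0) ->
    zeval v n g != 0 -> (forall z : int, z%:~R = 0 :> Omega -> z = 0) ->
  exists w : nat -> Omega,
    (forall f : zpoly n, zeval v n f = 0 -> zeval w n f = 0)
    /\ zeval w n g != 0.
Proof.
move=> K0 + O0; elim: n g => [|n IH] g.
  move=> /= nz; exists (fun=> 0); split=> [f /K0 -> //|/=].
  by apply: contraNneq nz => /O0 ->.
rewrite zevalS => /(extend_specialization Omega)[a /IH[w [ker wa]] ext].
have [c [kerc wc]] := ext (zeval w n) ker wa.
pose w' i := if i == n then c else w i.
have w'E f : zeval w' n.+1 f = (map_poly (zeval w n) f).[c].
  rewrite zevalS /w' eqxx; congr _.[_].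
  apply/polyP => i; rewrite !coef_map /=; apply: eq_zeval => j ltj.
  by rewrite (ltn_eqF ltj).
by exists w'; rewrite w'E; split=> // f; rewrite zevalS w'E; apply: kerc.
Qed.

(** * Prime ideals avoiding a multiplicative set, and their quotients *)

Section PrimeDisjoint.
Variables (R : comNzRingType) (I M : R -> Prop).
Hypothesis (MM : forall x y, M x -> M y -> M (x * y)).
Hypothesis IM : forall x, ideal_gen I x -> ~ M x.

Lemma ideal_gen_sub (P Q : R -> Prop) x :
  (forall y, P y -> ideal_gen Q y) -> ideal_gen P x -> ideal_gen Q x.
Proof.
move=> PQ; elim=> [y /PQ //||y z _ Py _ Pz|a y _ Py]; first exact: ideal_gen0.
  exact: ideal_genD.
exact: ideal_genM.
Qed.

Lemma ideal_gen_add1 (P : R -> Prop) a x :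
  ideal_gen (fun y => P y \/ y = a) x -> exists c, ideal_gen P (x - c * a).
Proof.
elim=> [y [Py|->]||y z _ [c Pc] _ [d Pd]|b y _ [c Pc]].
- by exists 0; rewrite mul0r subr0; apply: ideal_gen_base.
- by exists 1; rewrite mul1r subrr; apply: ideal_gen0.
- by exists 0; rewrite mul0r subrr; apply: ideal_gen0.
- by exists (c + d); rewrite mulrDl opprD addrACA; apply: ideal_genD.
- by exists (b * c); rewrite -mulrA -mulrBr; apply: ideal_genM.
Qed.

(* Zorn's lemma is applied to the sets J such that the ideal generated by I and J
   avoids M, rather than to ideals, so that the empty chain is no exception. *)
Lemma exists_prime_disjoint : exists P : R -> Prop,
  [/\ forall x, ideal_gen I x -> P x, forall x, ideal_gen P x -> P x,
      forall x, P x -> ~ M x & forall x y, P (x * y) -> P x \/ P y].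
Proof.
pose gI (J : R -> Prop) := ideal_gen (fun x => I x \/ J x).
have [F Ftot|J [JM maxJ]] := classical_sets.Zorn_bigcup
  (P := fun J => forall x, gI J x -> ~ M x).
  move=> chain x gx.
  (* A derivation uses finitely many members of the union, and the chain puts them all in one
     [J]. *)
  suff [/IM //|[J FJ gJ]] : ideal_gen I x \/ exists2 J, F J & gI J x.
    exact: Ftot gJ.
  elim: gx => [y [Iy|[J FJ Jy]]||y z _ Py _ Pz|a y _ Py].
  - by left; apply: ideal_gen_base.
  - by right; exists J => //; apply: ideal_gen_base; right.
  - by left; apply: ideal_gen0.
  - have I2J J u : ideal_gen I u -> gI J u.
      by apply: ideal_gen_sub => w Iw; apply: ideal_gen_base; left.
    have mono J J' u : (forall w, J w -> J' w) -> gI J u -> gI J' u.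
      move=> sub; apply: ideal_gen_sub => w Jw.
      by apply: ideal_gen_base; case: Jw => [|/sub]; [left|right].
    case: Py Pz => [Iy|[J FJ Jy]] [Iz|[J' FJ' Jz]].
    + by left; apply: ideal_genD.
    + by right; exists J' => //; apply: ideal_genD => //; apply: I2J.
    + by right; exists J => //; apply: ideal_genD => //; apply: I2J.
    + right; have [sub|sub] := chain _ _ FJ FJ'.
        by exists J' => //; apply: ideal_genD => //; apply: mono Jy => w /sub.
      by exists J => //; apply: ideal_genD => //; apply: mono Jz => w /sub.
  - case: Py => [Iy|[J FJ Jy]]; first by left; apply: ideal_genM.
    by right; exists J => //; apply: ideal_genM.
exists (gI J); split=> // [x|x|x y Jxy].
- by apply: ideal_gen_sub => y Iy; apply: ideal_gen_base; left.
- by apply: ideal_gen_sub => y.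
have [?|nJx] := pselect (gI J x); first by left.
have [?|nJy] := pselect (gI J y); first by right.
(* By maximality, adjoining [a] to [J] makes the generated ideal meet [M]. *)
have hit a : ~ gI J a -> exists2 m, M m & exists c, gI J (m - c * a).
  move=> nJa; apply: contrapT => nom.
  apply: (maxJ (fun w => J w \/ w = a)) => [|m gm Mm].
    split=> [|sub]; first by move=> w Jw; left.
    by apply: nJa; apply: ideal_gen_base; right; apply: sub; right.
  apply: nom; exists m => //; apply: ideal_gen_add1.
  by apply: ideal_gen_sub gm => w Jw; apply: ideal_gen_base; tauto.
have [m Mm [c Jm]] := hit _ nJx; have [m' Mm' [c' Jm']] := hit _ nJy.
case: (JM (m * m')) => [|]; last exact: MM.
have -> : m * m' = m' * (m - c * x) + c * x * (m' - c' * y) + (c * c') * (x * y).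
  rewrite !mulrBr [m' * m]mulrC -mulrA [m' * (c * x)]mulrC addrA.
  by rewrite subrK -!mulrA [x * (c' * y)]mulrCA subrK.
by do !apply: ideal_genD; apply: ideal_genM.
Qed.

End PrimeDisjoint.

Section PrimeQuotient.
Variables (R : comNzRingType) (P : R -> Prop).
Hypotheses (P1 : ~ P 1) (idealP : forall x, ideal_gen P x -> P x).
Hypothesis primeP : forall x y, P (x * y) -> P x \/ P y.

Definition prime_pred : {pred R} := fun x => `[< P x >].

Fact prime_pred_idealr : idealr_closed prime_pred.
Proof.
split=> [||a x y /asboolP Px /asboolP Py].
- by apply/asboolP/idealP; apply: ideal_gen0.
- exact/asboolPn.
- apply/asboolP/idealP; apply: ideal_genD; last exact: ideal_gen_base.
  exact/ideal_genM/ideal_gen_base.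
Qed.

Fact prime_pred_prime : prime_idealr_closed prime_pred.
Proof. by move=> x y /asboolP/primeP[] ?; apply/orP; [left|right]; apply/asboolP. Qed.

HB.instance Definition _ := isIdealr.Build R prime_pred prime_pred_idealr.
HB.instance Definition _ := isPrimeIdealrClosed.Build R prime_pred prime_pred_prime.

Definition prime_quot := Quotient.quot prime_pred.
HB.instance Definition _ := GRing.ComNzRing.on prime_quot.

(** The structure of integral domain includes an inverse on units, here chosen classically. *)
Definition quot_unit : {pred prime_quot} := fun x => `[< exists y, y * x = 1 >].
Definition quot_inv (x : prime_quot) : prime_quot :=
  if pselect (exists y, y * x = 1) is left ex then sval (cid ex) else x.

Fact quot_mulV : {in quot_unit, left_inverse 1 quot_inv *%R}.
Proof.
move=> x /asboolP ux; rewrite /quot_inv; case: pselect => // ex.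
exact: svalP (cid ex).
Qed.

Fact quot_unitPl (x y : prime_quot) : y * x = 1 -> quot_unit x.
Proof. by move=> yx; apply/asboolP; exists y. Qed.

Fact quot_inv_out : {in [predC quot_unit], quot_inv =1 id}.
Proof. by move=> x /asboolPn nux; rewrite /quot_inv; case: pselect. Qed.

HB.instance Definition _ := GRing.ComNzRing_hasMulInverse.Build prime_quot
  quot_mulV quot_unitPl quot_inv_out.

Fact quot_integral : GRing.integral_domain_axiom prime_quot.
Proof. exact: Quotient.rquot_IdomainAxiom. Qed.

HB.instance Definition _ :=
  GRing.ComUnitRing_isIntegral.Build prime_quot quot_integral.

Lemma prime_quotient : exists (K : idomainType) (f : {rmorphism R -> K}),
  forall x, f x = 0 <-> P x.
Proof.
pose f : {rmorphism R -> prime_quot} := \pi_(Quotient.quot prime_pred).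
exists prime_quot, f => x.
have -> : P x = is_true (x \in prime_pred) by apply/propext; split=> /asboolP.
rewrite -[x in x \in _]subr0 Quotient.idealrBE -(rmorph0 f).
exact: (rwP eqP).
Qed.

End PrimeQuotient.

Import mpoly.

Definition ieval (K : nzRingType) n (v : 'I_n -> K) (f : {mpoly int[n]}) : K :=
  mmap intr v f.

HB.instance Definition _ (K : comNzRingType) n (v : 'I_n -> K) :=
  GRing.RMorphism.copy (ieval v) (mmap intr v).

Lemma mpolyC_int n (c : int) : c%:MP_[n] = c%:~R.
Proof. by rewrite -[c in LHS]intz rmorph_int. Qed.

Lemma ievalX (K : comNzRingType) n (v : 'I_n -> K) i : ieval v 'X_i = v i.
Proof. by rewrite /ieval mmapX mmap1U. Qed.

Lemma ievalC (K : comNzRingType) n (v : 'I_n -> K) c : ieval v c%:MP = c%:~R.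
Proof. exact: mmapC. Qed.

Lemma rmorph_ieval (A B : comNzRingType) (phi : {rmorphism A -> B}) n
  (v : 'I_n -> A) f : phi (ieval v f) = ieval (fun i => phi (v i)) f.
Proof.
rewrite /ieval /mmap rmorph_sum; apply: eq_bigr => m _.
rewrite rmorphM /= rmorph_int /mmap1 rmorph_prod; congr (_ * _).
by apply: eq_bigr => i _; rewrite rmorphXn.
Qed.

(** A derivation uses only finitely many generators. This turns an infinite system of equations into
    a finite one. *)
Lemma ideal_gen_finite (R : comNzRingType) (S : R -> Prop) x : ideal_gen S x ->
  exists2 L : seq R, {in L, forall f, S f} &
    forall (B : comNzRingType) (phi : {rmorphism R -> B}),
      {in L, forall f, phi f = 0} -> phi x = 0.
Proof.
elim=> [y Sy||y z _ [L LS Ly] _ [L' LS' Lz]|a y _ [L LS Ly]].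
- exists [:: y] => [f|B phi]; first by rewrite inE => /eqP->.
  by apply; rewrite inE.
- by exists [::] => // B phi _; rewrite rmorph0.
- exists (L ++ L') => [f|B phi L0].
    by rewrite mem_cat => /orP[/LS|/LS'].
  rewrite rmorphD Ly ?Lz ?addr0 // => f Lf; apply: L0;
  by rewrite mem_cat Lf ?orbT.
- by exists L => // B phi /Ly y0; rewrite rmorphM y0 mulr0.
Qed.

(* If d and k do not exist, a prime ideal contains S but no d * g ^+ k: it does not
   meet the nonzero integers, and the classes of the variables modulo it
   specialize to a zero of S in algC at which g does not vanish. *)
Lemma nullstellensatz n (S : {mpoly int[n]} -> Prop) (g : {mpoly int[n]}) :
    (forall v : 'I_n -> algC, (forall f, S f -> ieval v f = 0) -> ieval v g = 0) ->
  exists (d : int) k, d != 0 /\ ideal_gen S (d%:MP * g ^+ k).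
Proof.
move=> vanish; apply: contrapT => no.
pose M (x : {mpoly int[n]}) := exists (d : int) k, d != 0 /\ x = d%:MP * g ^+ k.
have [|x Sx [d [k [d0 def_x]]]|P [SP idealP PM primeP]] :=
    @exists_prime_disjoint _ S M.
- move=> _ _ [d [k [d0 ->]]] [d' [k' [d'0 ->]]].
  exists (d * d'), (k + k')%N; rewrite mulf_neq0 //; split=> //.
  by rewrite mulrACA -exprD mpolyCM.
- by apply: no; exists d, k; rewrite -def_x.
have P1 : ~ P 1.
  by move=> /PM; apply; exists 1, 0%N; rewrite expr0 mulr1 mpolyC1.
have [K [phi kerphi]] := prime_quotient P1 idealP primeP.
pose v i := phi ('X_i).
pose vn (i : nat) := oapp v 0 (insub i).
have vnE (i : 'I_n) : vn i = v i by rewrite /vn valK.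
have phiE (B : comNzRingType) (w : nat -> B) f :
  ieval (fun i : 'I_n => w i) f =
    zeval w n (ieval (fun i : 'I_n => zvar n i) f).
  rewrite rmorph_ieval; congr (mmap _ _ f); apply/funext => i.
  by rewrite zeval_var.
have phi_v f : phi f = ieval (fun i : 'I_n => vn i) f.
  rewrite -[f in LHS](_ : ieval (fun i => 'X_i) f = f).
    rewrite rmorph_ieval; congr (mmap _ _ f); apply/funext => i; exact/esym.
  rewrite /ieval [RHS]mpolyE; apply: eq_bigr => m _.
  by rewrite mmap1_id -mul_mpolyC; congr (_ * _); rewrite mpolyC_int.
have algC0 (z : int) : z%:~R = 0 :> algC -> z = 0.
  by move/eqP; rewrite intr_eq0 => /eqP.
have K0 (z : int) : z%:~R = 0 :> K -> z = 0.
  rewrite -(rmorph_int phi) => /kerphi Pz; apply: contrapT => /eqP z0.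
  apply: (PM _ Pz); exists z, 0%N; split=> //; rewrite expr0 mulr1.
  by rewrite mpolyC_int.
have [|w [kerw wg]] := zpoly_specialization
  (g := ieval (fun i : 'I_n => zvar n i) g) K0 _ algC0 (v := vn).
  rewrite -phiE -phi_v; apply/eqP => /kerphi Pg; apply: (PM _ Pg).
  by exists 1, 1%N; rewrite expr1 mul1r.
move/eqP: wg; apply; rewrite -phiE; apply: vanish => f Sf.
rewrite phiE; apply: kerw; rewrite -phiE -phi_v; apply/kerphi/SP.
exact: ideal_gen_base.
Qed.

(** * Transfer of universal formulas to finite fields *)

Section Forms.
Variable n : nat.

(** Quantifier-free formulas whose atoms are equations with integer coefficients, so that they make
    sense over every field. *)
Inductive qfform :=
| FEq of {mpoly int[n]}
| FNot of qfform
| FAnd of qfform & qfform.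

Fixpoint feval (K : fieldType) (v : 'I_n -> K) (phi : qfform) : bool :=
  match phi with
  | FEq f => ieval v f == 0
  | FNot a => ~~ feval v a
  | FAnd a b => feval v a && feval v b
  end.

Definition FImp a b := FNot (FAnd a (FNot b)).
Definition FAll (s : seq qfform) := foldr FAnd (FEq 0) s.

Lemma fevalNot (K : fieldType) (v : 'I_n -> K) a :
  feval v (FNot a) = ~~ feval v a.
Proof. by []. Qed.

Lemma fevalAnd (K : fieldType) (v : 'I_n -> K) a b :
  feval v (FAnd a b) = feval v a && feval v b.
Proof. by []. Qed.

Lemma fevalImp (K : fieldType) (v : 'I_n -> K) a b :
  feval v (FImp a b) = (feval v a ==> feval v b).
Proof. by rewrite /=; case: (feval v a); rewrite //= negbK. Qed.

Lemma fevalAll (K : fieldType) (v : 'I_n -> K) s :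
  feval v (FAll s) = all (feval v) s.
Proof. by elim: s => /= [|a s <-//]; rewrite rmorph0 eqxx. Qed.

Implicit Type c : seq {mpoly int[n]} * {mpoly int[n]}.

(** A conjunction of literals needs a single inequation, because over a field inequations multiply
    into one. *)
Definition ceval (K : fieldType) (v : 'I_n -> K) c :=
  all (fun f => ieval v f == 0) c.1 && (ieval v c.2 != 0).

Fixpoint dnf (b : bool) (phi : qfform) : seq (seq {mpoly int[n]} * {mpoly int[n]}) :=
  match phi with
  | FEq f => if b then [:: ([:: f], 1)] else [:: ([::], f)]
  | FNot a => dnf (~~ b) a
  | FAnd a1 a2 =>
    if b then
      [seq (c1.1 ++ c2.1, c1.2 * c2.2) | c1 <- dnf true a1, c2 <- dnf true a2]
    else dnf false a1 ++ dnf false a2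
  end.

Lemma dnfP (K : fieldType) (v : 'I_n -> K) b phi :
  has (ceval v) (dnf b phi) = (feval v phi == b).
Proof.
elim: phi b => [f|a IH|a1 IH1 a2 IH2] [] /=; rewrite /ceval /= ?IH ?orbF ?andbT //.
- by rewrite rmorph1 oner_eq0 eqb_id !andbT.
- by case: (feval v a).
- by case: (feval v a).
- rewrite eqb_id; apply/hasP/andP => [[_ /allpairsP[[c1 c2] [/= m1 m2 ->]]]|[]].
    rewrite all_cat rmorphM mulf_eq0 negb_or /= => /andP[/andP[e1 e2] /andP[n1 n2]].
    split; rewrite -[feval _ _]eqb_id -?IH1 -?IH2; apply/hasP.
      by exists c1 => //; rewrite /ceval e1.
    by exists c2 => //; rewrite /ceval e2.
  rewrite -[feval v a1]eqb_id -[feval v a2]eqb_id -IH1 -IH2.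
  move=> /hasP[c1 m1 /andP[e1 n1]] /hasP[c2 m2 /andP[e2 n2]].
  exists (c1.1 ++ c2.1, c1.2 * c2.2); first by apply/allpairsP; exists (c1, c2).
  by rewrite all_cat e1 e2 rmorphM mulf_neq0.
- by rewrite has_cat IH1 IH2 !eqbF_neg negb_and.
Qed.

(** No point over [algC] satisfies the clause exactly when [c.2] vanishes at the common zeros of [S]
    and [c.1]. The Nullstellensatz certifies this by an integer identity, which is valid over every
    field where [d] is nonzero. *)
Lemma clause_transfer (S : {mpoly int[n]} -> Prop) c :
    (forall v : 'I_n -> algC, (forall f, S f -> ieval v f = 0) -> ~~ ceval v c) ->
  exists (L : seq {mpoly int[n]}) (d : int), [/\ {in L, forall f, S f}, d != 0 &
    forall (K : fieldType) (v : 'I_n -> K), d%:~R != 0 :> K ->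
      {in L, forall f, ieval v f = 0} -> ~~ ceval v c].
Proof.
move=> Sc; pose S' f := S f \/ f \in c.1.
have [v S'v|d [k [d0 /ideal_gen_finite[L LS' Lg]]]] :=
    @nullstellensatz _ S' c.2.
  apply/eqP/negPn/negP => nz; have /negP[] := Sc v (fun f Sf => S'v f (or_introl Sf)).
  by rewrite /ceval nz andbT; apply/allP => f cf; apply/eqP/S'v; right.
exists [seq f <- L | f \notin c.1], d; split=> [f|//|K v dK L0].
  by rewrite mem_filter => /andP[fc /LS'[//|]]; rewrite (negPf fc).
apply/andP => -[/allP c1 c2].
have /eqP : ieval v (d%:MP * c.2 ^+ k) = 0.
  apply: (Lg _ (ieval v)) => f Lf; have [/c1/eqP//|fc] := boolP (f \in c.1).
  by apply: L0; rewrite mem_filter fc.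
by rewrite rmorphM rmorphXn /= ievalC mulf_eq0 expf_eq0 (negPf dK) (negPf c2) andbF.
Qed.

(** The negation of [phi] is a finite disjunction of clauses, each excluded by its own certificate;
    the lists are concatenated and the integers multiplied. *)
Lemma form_transfer_compact (S : {mpoly int[n]} -> Prop) phi :
    (forall v : 'I_n -> algC, (forall f, S f -> ieval v f = 0) -> feval v phi) ->
  exists (L : seq {mpoly int[n]}) (d : int), [/\ {in L, forall f, S f}, d != 0 &
    forall (K : fieldType) (v : 'I_n -> K), d%:~R != 0 :> K ->
      {in L, forall f, ieval v f = 0} -> feval v phi].
Proof.
move=> Sphi.
have [L [d [LS d0 Ld]]] : exists (L : seq {mpoly int[n]}) (d : int),
    [/\ {in L, forall f, S f}, d != 0 &
    forall (K : fieldType) (v : 'I_n -> K), d%:~R != 0 :> K ->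
      {in L, forall f, ieval v f = 0} -> ~~ has (ceval v) (dnf false phi)].
  have : forall v : 'I_n -> algC, (forall f, S f -> ieval v f = 0) ->
      ~~ has (ceval v) (dnf false phi).
    by move=> v /Sphi; rewrite dnfP eqbF_neg negbK.
  elim: (dnf false phi) => [_|c s IH Scs]; first by exists [::], 1.
  have [v /Scs|L [d [LS d0 Ld]]] := @clause_transfer S c.
    by rewrite negb_or => /andP[].
  have [v /Scs|L' [d' [LS' d'0 Ld']]] := IH; first by rewrite negb_or => /andP[].
  exists (L ++ L'), (d * d'); split=> [f||K v].
  - by rewrite mem_cat => /orP[/LS|/LS'].
  - exact: mulf_neq0.
  rewrite rmorphM mulf_eq0 negb_or => /andP[dK d'K] L0 /=.
  by rewrite negb_or Ld ?Ld' // => f Lf; apply: L0; rewrite mem_cat Lf ?orbT.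
exists L, d; split=> // K v dK L0.
by have := Ld K v dK L0; rewrite dnfP eqbF_neg negbK.
Qed.

End Forms.

(** The exceptional characteristics are the primes dividing [d]. *)
Definition almost_all (P : finFieldType -> Prop) : Prop :=
  exists2 d : int, d != 0 & forall K : finFieldType, d%:~R != 0 :> K -> P K.

Lemma almost_allT (P : finFieldType -> Prop) : (forall K, P K) -> almost_all P.
Proof. by exists 1. Qed.

Lemma almost_allI2 (P Q T : finFieldType -> Prop) :
  (forall K, P K -> Q K -> T K) -> almost_all P -> almost_all Q -> almost_all T.
Proof.
move=> PQT [d d0 Pd] [e e0 Qe]; exists (d * e) => [|K]; first exact: mulf_neq0.
by rewrite rmorphM mulf_eq0 negb_or => /andP[/Pd PK /Qe QK]; apply: PQT.
Qed.

Lemma almost_all_mono (P Q : finFieldType -> Prop) :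
  (forall K, P K -> Q K) -> almost_all P -> almost_all Q.
Proof. by move=> PQ [d d0 Pd]; exists d => // K /Pd/PQ. Qed.

Lemma almost_all_in (T : eqType) (s : seq T) (P : T -> finFieldType -> Prop) :
  {in s, forall x, almost_all (P x)} ->
  almost_all (fun K => {in s, forall x, P x K}).
Proof.
elim: s => [|x s IH] Ps; first exact: almost_allT.
have: {in s, forall y, almost_all (P y)}.
  by move=> y sy; apply: Ps; rewrite inE sy orbT.
move=> /IH.
apply: almost_allI2 (Ps x (mem_head x s)) => K Px Pys y.
by rewrite inE => /predU1P[->//|/Pys].
Qed.

Lemma form_transfer n (phi : qfform n) : (forall v : 'I_n -> algC, feval v phi) ->
  almost_all (fun K => forall v : 'I_n -> K, feval v phi).
Proof.
move=> tr; have [//|L [d [Lno d0 Ld]]] :=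
  @form_transfer_compact n (fun=> False) phi.
by exists d => // K dK v; apply: Ld => // f /Lno.
Qed.

(** * Points of varieties over a field *)

Lemma qeval_mmap N (p : {mpoly rat[N]}) (v : 'rV[algC]_N) :
  qeval p v = mmap ratr (v ord0) p.
Proof.
rewrite /qeval {1}[p]mpolyE (raddf_sum (map_mpoly ratr)) (raddf_sum (meval _)).
apply: eq_bigr => m _ /=.
by rewrite map_mpolyZ map_mpolyX mevalZ mevalX.
Qed.

Definition int_mult N (d : int) (f : {mpoly rat[N]}) (g : {mpoly int[N]}) :=
  forall v : 'rV[algC]_N, ieval (v ord0) g = d%:~R * qeval f v.

Lemma int_multM N d (f : {mpoly rat[N]}) g e :
  int_mult d f g -> int_mult (e * d) f (e%:MP * g).
Proof. by move=> fg v; rewrite rmorphM /= ievalC fg rmorphM mulrA. Qed.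

Lemma ex_int_mult N (f : {mpoly rat[N]}) :
  exists g, exists2 d : int, d != 0 & int_mult d f g.
Proof.
have [d [g [d0 fg]]] : exists (d : int) (g : {mpoly int[N]}), d != 0 /\
    forall v : 'rV[algC]_N, ieval (v ord0) g = d%:~R * mmap ratr (v ord0) f.
  rewrite [f]mpolyE.
  elim/big_ind: _ => [|p q [d [g [d0 dg]]] [e [h [e0 eh]]]|m _].
  - by exists 1, 0; split=> // v; rewrite !rmorph0 mulr0.
  - exists (d * e), (e%:MP * g + d%:MP * h); split=> [|v]; first exact: mulf_neq0.
    rewrite rmorphD /= mmapD !rmorphM /= !ievalC dg eh mulrDr !mulrA.
    by rewrite [e%:~R * _]mulrC.
  pose c := f@_m; exists (denq c), ((numq c)%:MP * 'X_[m]).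
  split=> [|v]; first exact: denq_neq0.
  rewrite rmorphM mmapZ mmapX /= ievalC mulrA /ieval mmapX; congr (_ * _).
  rewrite /ratr mulrCA mulfV ?mulr1 //.
  by rewrite intr_eq0 denq_neq0.
by exists g, d => // v; rewrite fg qeval_mmap.
Qed.

(* An integral multiple of f. Over a field in which the multiplier is 0 its zeros
   are unrelated to f, so only statements on almost all fields are meaningful. *)
Definition zform N (f : {mpoly rat[N]}) : {mpoly int[N]} :=
  sval (cid (ex_int_mult f)).

Lemma zformP N (f : {mpoly rat[N]}) :
  exists2 d : int, d != 0 & int_mult d f (zform f).
Proof. exact: svalP (cid (ex_int_mult f)). Qed.

Lemma zform_eq0 N (f : {mpoly rat[N]}) (v : 'rV[algC]_N) :
  (ieval (v ord0) (zform f) == 0) = (qeval f v == 0).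
Proof.
by have [d d0 ->] := zformP f; rewrite mulf_eq0 intr_eq0 (negPf d0).
Qed.

(** The multiplier is common to all forms, since scaling them separately would change the projective
    point they define. *)
Lemma ex_int_mult_fam N M (h : 'I_M -> {mpoly rat[N]}) :
  exists (d : int) (g : 'I_M -> {mpoly int[N]}),
    d != 0 /\ forall j, int_mult d (h j) (g j).
Proof.
pose d j := sval (cid2 (zformP (h j))).
have dg j : d j != 0 /\ int_mult (d j) (h j) (zform (h j)).
  by rewrite /d; case: (cid2 _).
exists (\prod_j d j), (fun j => (\prod_(i | i != j) d i)%:MP * zform (h j));
  split=> [|j].
  by apply/prodf_neq0 => j _; case: (dg j).
by rewrite (bigD1 j) //= mulrC; apply: int_multM; case: (dg j).
Qed.

Section Points.
Variable K : fieldType.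

Definition vanishK N (s : seq {mpoly rat[N]}) (v : 'rV[K]_N) :=
  all (fun f => ieval (v ord0) (zform f) == 0) s.

Definition ptK N (X : qpvar N) (v : 'rV[K]_N) :=
  [&& v != 0, vanishK (qp_eqs X) v & ~~ vanishK (qp_neqs X) v].

(** Proportionality as the vanishing of 2 by 2 minors, which can be expressed by a [qfform]. *)
Definition parallel N (u w : 'rV[K]_N) :=
  [forall i, forall j, u ord0 i * w ord0 j == u ord0 j * w ord0 i].

Lemma parallelP N (u w : 'rV[K]_N) : u != 0 -> w != 0 ->
  reflect (exists2 c, c != 0 & w = c *: u) (parallel u w).
Proof.
move=> u0 w0; apply: (iffP forallP) => [par|[c c0 ->] i]; last first.
  by apply/forallP => j; rewrite !mxE mulrCA [eqbRHS]mulrCA [u ord0 j * _]mulrC.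
have /rV0Pn[i ui] := u0.
have def_w : w = (w ord0 i / u ord0 i) *: u.
  apply/rowP => j; rewrite mxE mulrAC; apply: (canRL (mulfK ui)).
  by have /forallP/(_ j)/eqP := par i; rewrite mulrC => ->; rewrite mulrC.
exists (w ord0 i / u ord0 i) => //.
by apply: contraNneq w0 => c0; rewrite def_w c0 scale0r.
Qed.

End Points.

Lemma vanishKE N s (v : 'rV[algC]_N) : vanishK s v = vanish s v.
Proof. by apply: eq_all => f; rewrite zform_eq0. Qed.

Lemma ptKE N (X : qpvar N) (v : 'rV[algC]_N) : ptK X v = qp_pt X v.
Proof. by rewrite /ptK !vanishKE. Qed.

Section PointForms.
Variables (n N : nat).
Implicit Type s : 'I_N -> {mpoly int[n]}.

Definition zsubst s (f : {mpoly int[N]}) : {mpoly int[n]} := ieval s f.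

(** The family [s] is a symbolic point whose coordinates are polynomials in the variables of a
    formula; [vecK] is its value. *)
Definition vecK (K : fieldType) (e : 'I_n -> K) s : 'rV[K]_N :=
  \row_i ieval e (s i).

Lemma ieval_vecK (K : fieldType) (e : 'I_n -> K) s f :
  ieval e (zsubst s f) = ieval (vecK e s ord0) f.
Proof.
by rewrite [LHS]rmorph_ieval; congr (mmap _ _ f); apply/funext => i; rewrite mxE.
Qed.

Definition FZero s := FAll [seq FEq (s i) | i <- enum 'I_N].

Lemma feval_zero (K : fieldType) (e : 'I_n -> K) s :
  feval e (FZero s) = (vecK e s == 0).
Proof.
rewrite fevalAll all_map; apply/allP/eqP => [e0|/rowP e0 i _] /=; last first.
  by have := e0 i; rewrite !mxE => ->.
by apply/rowP => i; rewrite !mxE; apply/eqP/e0; rewrite mem_enum.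
Qed.

Definition FVanish s l := FAll [seq FEq (zsubst s (zform f)) | f <- l].

Lemma feval_vanish (K : fieldType) (e : 'I_n -> K) s l :
  feval e (FVanish s l) = vanishK l (vecK e s).
Proof.
by rewrite fevalAll all_map; apply: eq_all => f /=; rewrite ieval_vecK.
Qed.

Definition FPt (X : qpvar N) s :=
  FAnd (FNot (FZero s)) (FAnd (FVanish s (qp_eqs X)) (FNot (FVanish s (qp_neqs X)))).

Lemma feval_pt (K : fieldType) (e : 'I_n -> K) X s :
  feval e (FPt X s) = ptK X (vecK e s).
Proof. by rewrite /= feval_zero !feval_vanish. Qed.

Definition FPar s t :=
  FAll [seq FEq (s ij.1 * t ij.2 - s ij.2 * t ij.1) | ij <- enum {: 'I_N * 'I_N}].

Lemma feval_par (K : fieldType) (e : 'I_n -> K) s t :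
  feval e (FPar s t) = parallel (vecK e s) (vecK e t).
Proof.
rewrite fevalAll all_map; apply/allP/forallP => [e0 i|e0 [i j] _] /=.
  apply/forallP => j; have := e0 (i, j); rewrite mem_enum => /(_ isT) /=.
  by rewrite rmorphB !rmorphM subr_eq0 /= !mxE.
have /forallP/(_ j) := e0 i.
by rewrite !mxE rmorphB !rmorphM subr_eq0.
Qed.

End PointForms.

(** * Invariance of point counts *)

Lemma qeval_homog N d (f : {mpoly rat[N]}) c (v : 'rV[algC]_N) :
  f \is d.-homog -> qeval f (c *: v) = c ^+ d * qeval f v.
Proof.
move=> /dhomogP hf; rewrite !qeval_mmap /mmap mulr_sumr.
rewrite big_seq [RHS]big_seq; apply: eq_bigr => m /hf <-.
rewrite mulrCA /mmap1 /= mdegE -prodrXr -big_split /=; congr (_ * _).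
by apply: eq_bigr => i _; rewrite mxE exprMn.
Qed.

Lemma vanish_scale N s c (v : 'rV[algC]_N) : c != 0 ->
  all (fun p => p \is homog mdeg) s -> vanish s (c *: v) = vanish s v.
Proof.
move=> c0 /allP hs; apply: eq_in_all => f /hs/homogP[d hf].
by rewrite (qeval_homog _ _ hf) mulf_eq0 expf_eq0 (negPf c0) andbF.
Qed.

Lemma qp_pt_scale N (X : qpvar N) c v : c != 0 -> qp_pt X (c *: v) = qp_pt X v.
Proof.
move=> c0; have := valP X; rewrite all_cat => /andP[h1 h2].
by rewrite /qp_pt scaler_eq0 (negPf c0) !vanish_scale.
Qed.

Lemma same_pt_sym N (u v : 'rV[algC]_N) : same_pt u v -> same_pt v u.
Proof.
by case=> c c0 ->; exists c^-1; rewrite ?invr_eq0 // scalerA mulVf // scale1r.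
Qed.

Lemma same_pt_trans N (v u w : 'rV[algC]_N) :
  same_pt u v -> same_pt v w -> same_pt u w.
Proof.
move=> [c c0 ->] [d d0 ->]; exists (c * d); rewrite ?scalerA //.
exact: mulf_neq0.
Qed.

Lemma same_pt_qp N (X : qpvar N) u v : same_pt u v -> qp_pt X u -> qp_pt X v.
Proof. by case=> c c0 ->; rewrite qp_pt_scale. Qed.

Lemma same_pt_scale N M (F : 'rV[algC]_N -> 'rV[algC]_M) d u v :
  (forall c v, F (c *: v) = c ^+ d *: F v) -> same_pt u v -> same_pt (F u) (F v).
Proof. by move=> hF [c c0 ->]; exists (c ^+ d); rewrite ?expf_neq0. Qed.

Section Counting.
Variable K : finFieldType.

Definition pcard N (X : qpvar N) : nat := #|[pred v : 'rV[K]_N | ptK X v]|.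

Lemma card_line N (u : 'rV[K]_N) : u != 0 ->
  #|[pred w : 'rV[K]_N | (w != 0) && parallel u w]| = #|K|.-1.
Proof.
move=> u0; rewrite -(cardC1 (0 : K)).
have inj : injective (fun c : K => c *: u).
  move=> c d /eqP; rewrite -subr_eq0 -scalerBl scaler_eq0 (negPf u0) orbF subr_eq0.
  by move/eqP.
rewrite -(card_image inj); apply: eq_card => w; rewrite !inE.
apply/andP/imageP => [[w0 /parallelP[]// c c0 ->]|[c c0 ->]]; first by exists c.
have w0 : c *: u != 0 by rewrite scaler_eq0 negb_or u0 andbT.
by split=> //; apply/parallelP => //; exists c.
Qed.

(** Translation by 1 permutes [K], so it does not change the sum of all elements. *)
Lemma finField_natr_card : #|K|%:R = 0 :> K.
Proof.
have /eqP : \sum_(x : K) (x + 1) = \sum_(x : K) x.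
  by rewrite [RHS](reindex_inj (addIr 1)).
rewrite big_split /= sumr_const.
by rewrite -subr_eq0 addrAC subrr add0r => /eqP.
Qed.

Lemma finField_natr_pred : #|K|.-1%:R = -1 :> K.
Proof.
have K0 : (0 < #|K|)%N by apply/card_gt0P; exists 0.
apply/eqP; rewrite -addr_eq0 natr1 prednK //; apply/eqP.
exact: finField_natr_card.
Qed.

(* Both sides are -1 times the number of pairs (v, w) of vectors such that the
   point of w is the image of the point of v. *)
Lemma chart_count N M (A : pred 'rV[K]_N) (B : pred 'rV[K]_M)
    (hs : seq ('rV[K]_N -> 'rV[K]_M)) (gs : seq ('rV[K]_M -> 'rV[K]_N)) :
    (forall v, A v -> v != 0) -> (forall w, B w -> w != 0) ->
    (forall v, A v -> has (fun h => h v != 0) hs) ->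
    (forall w, B w -> has (fun g => g w != 0) gs) ->
    (forall i j v w, A v -> nth (fun=> 0) hs i v != 0 -> w != 0 ->
       parallel (nth (fun=> 0) hs i v) w ->
       B w /\ (nth (fun=> 0) gs j w != 0 -> parallel (nth (fun=> 0) gs j w) v)) ->
    (forall i j v w, B w -> nth (fun=> 0) gs j w != 0 -> v != 0 ->
       parallel (nth (fun=> 0) gs j w) v ->
       A v /\ (nth (fun=> 0) hs i v != 0 -> parallel (nth (fun=> 0) hs i v) w)) ->
  #|A|%:R = #|B|%:R :> K.
Proof.
move=> A0 B0 Ah Bg AB BA.
(* The first chart that does not vanish at [v]; as the hypotheses concern all pairs of charts, the
   choice is harmless. *)
pose chart m n (fs : seq ('rV[K]_m -> 'rV[K]_n)) v :=
  nth (fun=> 0) fs (find (fun f => f v != 0) fs) v.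
have chart_neq0 m n (fs : seq ('rV[K]_m -> 'rV[K]_n)) v :
    has (fun f => f v != 0) fs -> chart _ _ fs v != 0 by apply: nth_find.
pose R v w := (w != 0) && parallel (chart _ _ hs v) w.
pose R' v w := (v != 0) && parallel (chart _ _ gs w) v.
have eqR v w : A v && R v w = B w && R' v w.
  apply/andP/andP => [[Av /andP[w0 par]]|[Bw /andP[v0 par]]].
    have Bw j := AB _ j v w Av (chart_neq0 _ _ _ _ (Ah v Av)) w0 par.
    have [Bw0 _] := Bw 0%N; split=> //; rewrite /R' (A0 _ Av) /=.
    by apply: (Bw _).2; apply: chart_neq0; apply: Bg.
  have Av i := BA i _ v w Bw (chart_neq0 _ _ _ _ (Bg w Bw)) v0 par.
  have [Av0 _] := Av 0%N; split=> //; rewrite /R (B0 _ Bw) /=.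
  by apply: (Av _).2; apply: chart_neq0; apply: Ah.
have cA : (\sum_(v | A v) \sum_(w | R v w) 1 = #|A| * #|K|.-1)%N.
  rewrite -sum_nat_const; apply: eq_bigr => v Av; rewrite sum1_card.
  by apply: card_line; apply: chart_neq0; apply: Ah.
have cB : (\sum_(w | B w) \sum_(v | R' v w) 1 = #|B| * #|K|.-1)%N.
  rewrite -sum_nat_const; apply: eq_bigr => w Bw; rewrite sum1_card.
  by apply: card_line; apply: chart_neq0; apply: Bg.
have: (#|A| * #|K|.-1 = #|B| * #|K|.-1)%N.
  rewrite -cA -cB (exchange_big_dep B) /= => [|v w Av Rvw].
    apply: eq_bigr => w Bw; apply: eq_bigl => v.
    by rewrite eqR Bw.
  by have := eqR v w; rewrite Av Rvw => /esym/andP[].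
move/(congr1 (fun k : nat => k%:R : K)).
by rewrite !natrM finField_natr_pred !mulrN1 => /oppr_inj.
Qed.

End Counting.

Lemma rV_funE (K : fieldType) n (e : 'I_n -> K) : (\row_i e i) ord0 = e.
Proof. by apply/funext => i; rewrite mxE. Qed.

Lemma transfer_row n (phi : qfform n) :
    (forall v : 'rV[algC]_n, feval (v ord0) phi) ->
  almost_all (fun K => forall v : 'rV[K]_n, feval (v ord0) phi).
Proof.
move=> tr; have := @form_transfer n phi.
case=> [v|d d0 Kphi]; first by have := tr (\row_i v i); rewrite rV_funE.
by exists d => // K dK v; apply: Kphi.
Qed.

Definition idv n (i : 'I_n) : {mpoly int[n]} := 'X_i.
Definition lv n m (i : 'I_n) : {mpoly int[n + m]} := 'X_(lshift m i).
Definition rv n m (j : 'I_m) : {mpoly int[n + m]} := 'X_(rshift n j).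

Lemma vecK_id (K : fieldType) n (v : 'rV[K]_n) : vecK (v ord0) (@idv n) = v.
Proof. by apply/rowP => i; rewrite mxE ievalX. Qed.

Lemma vecK_idf (K : fieldType) n (e : 'I_n -> K) : vecK e (@idv n) = \row_i e i.
Proof. by apply/rowP => i; rewrite !mxE ievalX. Qed.

Lemma vecK_l (K : fieldType) n m (v : 'rV[K]_n) (w : 'rV[K]_m) :
  vecK (row_mx v w ord0) (@lv n m) = v.
Proof. by apply/rowP => i; rewrite mxE ievalX row_mxEl. Qed.

Lemma vecK_r (K : fieldType) n m (v : 'rV[K]_n) (w : 'rV[K]_m) :
  vecK (row_mx v w ord0) (@rv n m) = w.
Proof. by apply/rowP => i; rewrite mxE ievalX row_mxEr. Qed.

Lemma transfer_row_mx n m (phi : qfform (n + m)) :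
    (forall (v : 'rV[algC]_n) (w : 'rV[algC]_m), feval (row_mx v w ord0) phi) ->
  almost_all (fun K => forall (v : 'rV[K]_n) (w : 'rV[K]_m),
    feval (row_mx v w ord0) phi).
Proof.
move=> tr; apply: almost_all_mono (@transfer_row _ phi _) => [K Kphi v w //|v].
by rewrite -[v]hsubmxK.
Qed.

(** * Isomorphisms: comparing points through finitely many charts *)

Section Isomorphism.
Variables (N M : nat).

Definition chart (K : fieldType) n m (H : 'I_m -> {mpoly int[n]}) (v : 'rV[K]_n) :=
  vecK (v ord0) H.

Lemma chart_subst (K : fieldType) n k m (e : 'I_n -> K) (s : 'I_k -> {mpoly int[n]})
  (H : 'I_m -> {mpoly int[k]}) :
  vecK e (fun j => zsubst s (H j)) = chart H (vecK e s).
Proof. by apply/rowP => j; rewrite !mxE ieval_vecK. Qed.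

(** Charts are finite functions so that they form an [eqType] and can be listed. *)
Definition good_chart (X : qpvar N) (f : 'rV[algC]_N -> 'rV[algC]_M)
    (H : {ffun 'I_M -> {mpoly int[N]}}) :=
  (exists d, forall c (v : 'rV[algC]_N), chart H (c *: v) = c ^+ d *: chart H v) /\
  (forall w, qp_pt X w -> chart H w != 0 -> same_pt (f w) (chart H w)).

Lemma good_chart_of_forms (X : qpvar N) f d (h : 'I_M -> {mpoly rat[N]}) :
    (forall j, h j \is d.-homog) ->
    (forall w, qp_pt X w -> formmap h w != 0 -> same_pt (f w) (formmap h w)) ->
  exists2 H : {ffun 'I_M -> {mpoly int[N]}}, good_chart X f H &
    forall v : 'rV[algC]_N, formmap h v != 0 -> chart H v != 0.
Proof.
move=> hd hf; have [a [H [a0 aH]]] := ex_int_mult_fam h.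
have HE v : chart (finfun H) v = a%:~R *: formmap h v.
  by apply/rowP => j; rewrite !mxE ffunE aH.
have a0' : (a%:~R : algC) != 0 by rewrite intr_eq0.
exists (finfun H) => [|v]; last by rewrite HE scaler_eq0 negb_or a0'.
split=> [|w Xw].
  exists d => c v; rewrite !HE scalerA mulrC -scalerA; congr (_ *: _).
  by apply/rowP => j; rewrite !mxE (qeval_homog _ _ (hd j)).
rewrite HE scaler_eq0 negb_or a0' => /(hf _ Xw)/same_pt_trans; apply.
by apply: same_pt_sym; exists a%:~R.
Qed.

(* All the charts of f together cover X, and the certificate that they do
   involves only finitely many of them. *)
Lemma finite_charts (X : qpvar N) (Y : qpvar M) f : regular_map X Y f ->
  exists2 Hs : seq {ffun 'I_M -> {mpoly int[N]}}, {in Hs, forall H, good_chart X f H} &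
    almost_all (fun K => forall v : 'rV[K]_N, ptK X v ->
      has (fun H : {ffun _ -> _} => chart H v != 0) Hs).
Proof.
move=> [_ fX].
(* The coordinates of all good charts: by regularity they have no common zero on [X] over [algC]. *)
pose S p := exists2 H : {ffun 'I_M -> {mpoly int[N]}}, good_chart X f H &
  exists j, p = H j.
have [v Sv|L [d [LS d0 Ld]]] := @form_transfer_compact N S (FNot (FPt X (@idv N))).
  rewrite fevalNot feval_pt; apply/negP.
  rewrite vecK_idf. rewrite ptKE => /fX[k [h [hk h0 hf]]].
  have [H gH /(_ _ h0)/rV0Pn[j]] := good_chart_of_forms hk hf.
  by rewrite mxE rV_funE => /eqP; apply; apply: Sv; exists H => //; exists j.
have {LS} [Hs gHs LHs] : exists2 Hs : seq {ffun 'I_M -> {mpoly int[N]}},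
    {in Hs, forall H, good_chart X f H} &
    {in L, forall p, exists2 H, H \in Hs & exists j, p = H j}.
  elim: L LS {Ld} => [|p L IH] LS; first by exists [::].
  have [|Hs gHs LHs] := IH; first by move=> q Lq; apply: LS; rewrite inE Lq orbT.
  have [H gH [j def_p]] := LS p (mem_head _ _).
  exists (H :: Hs) => [G|q]; rewrite inE => /predU1P[->//|].
  - exact: gHs.
  - by exists H; [apply: mem_head|exists j].
  - by move=> /LHs[G GHs Gj]; exists G; rewrite // inE GHs orbT.
exists Hs => //; exists d => // K dK v Xv; apply: contrapT => /negP/hasPn no.
suff L0 : {in L, forall p, ieval (v ord0) p = 0}.
  by have := Ld K (v ord0) dK L0; rewrite fevalNot feval_pt vecK_id Xv.
move=> p /LHs[H /no/negPn/eqP/rowP H0 [j ->]].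
by have := H0 j; rewrite !mxE.
Qed.

End Isomorphism.

Definition compat_charts (K : fieldType) N M (X : qpvar N) (Y : qpvar M)
    (H : {ffun 'I_M -> {mpoly int[N]}}) (G : {ffun 'I_N -> {mpoly int[M]}}) : Prop :=
  forall (v : 'rV[K]_N) (w : 'rV[K]_M), ptK X v -> chart H v != 0 -> w != 0 ->
    parallel (chart H v) w ->
  ptK Y w /\ (chart G w != 0 -> parallel (chart G w) v).

(** Over [algC], [w] represents [f v], hence lies in [Y], and [G] sends it to the point of
    [g (f v)], that is of [v]. Only polynomials in [v] and [w] occur, so this transfers although [f]
    and [g] have no meaning over [K]. *)
Lemma compat_charts_transfer N M (X : qpvar N) (Y : qpvar M) f g
    (H : {ffun 'I_M -> {mpoly int[N]}}) (G : {ffun 'I_N -> {mpoly int[M]}}) :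
    regular_map X Y f ->
    (forall v, qp_pt X v -> same_pt (g (f v)) v) ->
    good_chart X f H -> good_chart Y g G ->
  almost_all (fun K => compat_charts K X Y H G).
Proof.
move=> [fY _] gf [_ fH] [[d Gd] gG].
pose Hl (j : 'I_M) := zsubst (@lv N M) (H j); pose Gr (i : 'I_N) := zsubst (@rv N M) (G i).
pose phi := FImp (FAnd (FPt X (@lv N M)) (FAnd (FNot (FZero Hl))
    (FAnd (FNot (FZero (@rv N M))) (FPar Hl (@rv N M)))))
  (FAnd (FPt Y (@rv N M)) (FImp (FNot (FZero Gr)) (FPar Gr (@lv N M)))).
have phiE (K : fieldType) (v : 'rV[K]_N) (w : 'rV[K]_M) :
  feval (row_mx v w ord0) phi =
    ([&& ptK X v, chart H v != 0, w != 0 & parallel (chart H v) w] ==>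
    (ptK Y w && ((chart G w != 0) ==> parallel (chart G w) v))).
  rewrite !(fevalImp, fevalAnd, fevalNot, feval_pt, feval_zero, feval_par).
  by rewrite !chart_subst vecK_l vecK_r.
apply: almost_all_mono (@transfer_row_mx _ _ phi _) => [K Kphi v w Xv Hv w0 par|v w].
  by have := Kphi v w; rewrite phiE Xv Hv w0 par /= => /andP[-> /implyP].
rewrite phiE; apply/implyP => /and4P[Xv Hv w0 /(parallelP Hv w0)[c c0 def_w]].
rewrite ptKE in Xv; rewrite ptKE.
have fv_w : same_pt (f v) w.
  apply: same_pt_trans (fH v Xv Hv) _; apply: same_pt_sym; by exists c.
have Yw : qp_pt Y w := same_pt_qp fv_w (fY _ Xv).
rewrite Yw; apply/implyP => Gw.
have v0 : v != 0 by case/and3P: Xv.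
have GG := same_pt_scale Gd fv_w.
have Gfv : chart G (f v) != 0.
  by case: GG => e e0 ->; rewrite scaler_eq0 negb_or e0.
apply/parallelP => //; suff [e e0 ->] : same_pt v (chart G w) by exists e.
apply: same_pt_trans (same_pt_sym (gf _ Xv)) _.
exact: same_pt_trans (gG _ (fY _ Xv) Gfv) GG.
Qed.

(* The cone over X has (#|K| - 1) * #|X(K)| nonzero points, and #|K| - 1 = -1 in K:
   this is the number of K-points of X modulo the characteristic. *)
Definition pcount (K : finFieldType) N (X : qpvar N) : K := - (pcard K X)%:R.

(** The zero chart stands for the default value of [nth] in [chart_count], where the indices are
    unbounded. *)
Lemma good_chart0 N M (X : qpvar N) (f : 'rV[algC]_N -> 'rV[algC]_M) :
  good_chart X f [ffun=> 0].
Proof.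
have c0 v : chart [ffun=> 0 : {mpoly int[N]}] v = 0 :> 'rV[algC]_M.
  by apply/rowP => j; rewrite !mxE ffunE rmorph0.
split=> [|w _]; last by rewrite c0 eqxx.
by exists 0%N => c v; rewrite !c0 scaler0.
Qed.

Lemma nth_chart (K : fieldType) N M (Hs : seq {ffun 'I_M -> {mpoly int[N]}}) i
    (v : 'rV[K]_N) : exists2 H, H \in [ffun=> 0] :: Hs &
  nth (fun=> 0) [seq (fun v : 'rV[K]_N => chart (H : {ffun _ -> _}) v) | H <- Hs] i v
    = chart H v.
Proof.
have [lt|ge] := ltnP i (size Hs).
  exists (nth [ffun=> 0] Hs i); first by rewrite inE mem_nth ?orbT.
  by rewrite (nth_map [ffun=> 0]).
exists [ffun=> 0]; first exact: mem_head.
rewrite nth_default ?size_map //.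
by apply/rowP => j; rewrite !mxE ffunE rmorph0.
Qed.

Lemma pcount_iso N M (X : qpvar N) (Y : qpvar M) : qp_iso X Y ->
  almost_all (fun K => pcount K X = pcount K Y).
Proof.
move=> [f [g [fr gr gf fg]]].
have [Hs gHs Hcov] := finite_charts fr; have [Gs gGs Gcov] := finite_charts gr.
have HG : almost_all (fun K =>
    {in [ffun=> 0] :: Hs, forall H, {in [ffun=> 0] :: Gs, forall G,
    compat_charts K X Y H G /\ compat_charts K Y X G H}}).
  apply: almost_all_in => H HHs; apply: almost_all_in => G GGs.
  have gH : good_chart X f H.
    by move: HHs; rewrite inE => /predU1P[->|/gHs//]; apply: good_chart0.
  have gG : good_chart Y g G.
    by move: GGs; rewrite inE => /predU1P[->|/gGs//]; apply: good_chart0.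
  have c1 := compat_charts_transfer fr gf gH gG.
  have c2 := compat_charts_transfer gr fg gG gH.
  exact: almost_allI2 (fun K a b => conj a b) c1 c2.
apply: almost_allI2 (almost_allI2 (fun K a b => conj a b) Hcov Gcov) HG.
move=> K [Kcov Gcov'] compat; congr (- _).
apply: (@chart_count K N M (fun v => ptK X v) (fun w => ptK Y w)
  [seq (fun v => chart (H : {ffun _ -> _}) v) | H <- Hs]
  [seq (fun w => chart (G : {ffun _ -> _}) w) | G <- Gs]).
- by move=> v /and3P[].
- by move=> v /and3P[].
- by move=> v /Kcov; rewrite has_map.
- by move=> v /Gcov'; rewrite has_map.
- move=> i j v w; have [H HHs ->] := nth_chart Hs i v.
  by have [G GGs ->] := nth_chart Gs j w; apply: (compat H HHs G GGs).1.
- move=> i j v w; have [H HHs ->] := nth_chart Hs i v.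
  by have [G GGs ->] := nth_chart Gs j w; apply: (compat H HHs G GGs).2.
Qed.

Lemma pcount_scissor N (X Y U : qpvar N) :
  closed_in Y X -> complement_of U X Y ->
  almost_all (fun K => pcount K X = pcount K U + pcount K Y).
Proof.
move=> [H _ YX] UXY; pose P Z := FPt Z (@idv N).
pose phi := FAnd (FImp (P Y) (P X))
  (FAnd (FImp (P U) (FAnd (P X) (FNot (P Y)))) (FImp (FAnd (P X) (FNot (P Y))) (P U))).
have phiE (K : fieldType) (v : 'rV[K]_N) : feval (v ord0) phi ->
    (ptK X v && ptK Y v = ptK Y v) /\ (ptK X v && ~~ ptK Y v = ptK U v).
  rewrite /phi /P !(fevalAnd, fevalImp, fevalNot, feval_pt) vecK_id.
  by case: (ptK X v) (ptK Y v) (ptK U v) => [] [] [].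
apply: almost_all_mono (@transfer_row _ phi _) => [K Kphi|v]; last first.
  rewrite /phi /P !(fevalAnd, fevalImp, fevalNot, feval_pt) vecK_id !ptKE.
  by rewrite UXY YX; case: (qp_pt X v) (vanish H v) => [] [].
rewrite /pcount -opprD -natrD /pcard; congr (- _%:R).
rewrite -(cardID (fun v => ptK Y v)) addnC; congr (_ + _)%N; apply: eq_card => v;
rewrite !inE -?topredE /=; have [e1 e2] := phiE _ _ (Kphi v).
  by rewrite -[RHS]e2 andbC.
by rewrite -[RHS]e1.
Qed.

(** Invariance under scaling is transferred from [algC], because [zform] is specified only through
    its values there. *)
Lemma parallel_transfer n (W : qpvar n) : almost_all (fun K =>
  forall u w : 'rV[K]_n, ptK W u -> w != 0 -> parallel u w -> ptK W w).
Proof.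
pose phi := FImp (FAnd (FPt W (@lv n n)) (FAnd (FNot (FZero (@rv n n)))
  (FPar (@lv n n) (@rv n n)))) (FPt W (@rv n n)).
have phiE (K : fieldType) (v w : 'rV[K]_n) : feval (row_mx v w ord0) phi =
    ([&& ptK W v, w != 0 & parallel v w] ==> ptK W w).
  rewrite !(fevalImp, fevalAnd, fevalNot, feval_pt, feval_zero, feval_par).
  by rewrite vecK_l vecK_r.
apply: almost_all_mono (@transfer_row_mx _ _ phi _) => [K Kphi v w Wv w0 par|v w].
  by have := Kphi v w; rewrite phiE Wv w0 par.
rewrite phiE; apply/implyP => /and3P[Wv w0]; have v0 : v != 0 by case/and3P: Wv.
by move=> /(parallelP v0 w0)[c c0 ->]; rewrite ptKE qp_pt_scale // -ptKE.
Qed.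

(** * Point counts of Segre products *)

Section Product.
Variables (N M : nat) (X : qpvar N) (Y : qpvar M) (Z : qpvar (N * M)%N).

Definition segre (R : comNzRingType) (x : 'rV[R]_N) (y : 'rV[R]_M) := mxvec (x^T *m y).

Lemma segreE (R : comNzRingType) (x : 'rV[R]_N) (y : 'rV[R]_M) i j :
  segre x y ord0 (mxvec_index i j) = x ord0 i * y ord0 j.
Proof. by rewrite /segre mxvecE mxE big_ord1 mxE. Qed.

(** On a Segre image, read as a matrix of rank one, each column is a multiple of the first factor
    and each row a multiple of the second. *)
Definition zcol (R : comNzRingType) (z : 'rV[R]_(N * M)) j : 'rV[R]_N :=
  \row_i z ord0 (mxvec_index i j).
Definition zrow (R : comNzRingType) (z : 'rV[R]_(N * M)) i : 'rV[R]_M :=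
  \row_j z ord0 (mxvec_index i j).

Hypothesis XYZ : segre_product X Y Z.

Lemma segre_transfer : almost_all (fun K =>
  forall (x : 'rV[K]_N) (y : 'rV[K]_M), ptK X x -> ptK Y y -> ptK Z (segre x y)).
Proof.
pose seg := segre (\row_i lv M i) (\row_j rv N j) ord0.
have vec_seg (K : fieldType) (x : 'rV[K]_N) (y : 'rV[K]_M) :
    vecK (row_mx x y ord0) seg = segre x y.
  apply/rowP => k; rewrite mxE; case/mxvec_indexP: k => i j.
  by rewrite /seg !segreE !mxE rmorphM /= !ievalX row_mxEl row_mxEr.
pose phi := FImp (FAnd (FPt X (@lv N M)) (FPt Y (@rv N M))) (FPt Z seg).
have phiE (K : fieldType) (x : 'rV[K]_N) (y : 'rV[K]_M) :
    feval (row_mx x y ord0) phi = (ptK X x && ptK Y y ==> ptK Z (segre x y)).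
  by rewrite !(fevalImp, fevalAnd, feval_pt) vecK_l vecK_r vec_seg.
apply: almost_all_mono (@transfer_row_mx _ _ phi _) => [K Kphi x y Xx Yy|x y].
  by have := Kphi x y; rewrite phiE Xx Yy.
rewrite phiE !ptKE; apply/implyP => /andP[Xx Yy].
by apply/(XYZ _).2; exists x, y.
Qed.

(** This removes the existential quantifiers from [segre_product]: where the coordinate [(i, j)] is
    nonzero, column [j] and row [i] serve as factors, and the minors through [(i, j)] express rank
    one. *)
Lemma segre_inv_transfer : almost_all (fun K => forall (z : 'rV[K]_(N * M)) i j,
  ptK Z z -> z ord0 (mxvec_index i j) != 0 ->
  [/\ ptK X (zcol z j), ptK Y (zrow z i) &
    forall i' j', z ord0 (mxvec_index i' j') * z ord0 (mxvec_index i j) =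
      z ord0 (mxvec_index i' j) * z ord0 (mxvec_index i j')]).
Proof.
pose zv i j := idv (@mxvec_index N M i j).
pose phi i j := FImp (FAnd (FPt Z (@idv (N * M)%N)) (FNot (FEq (zv i j))))
  (FAnd (FAnd (FPt X (zv^~ j)) (FPt Y (zv i)))
    (FAll [seq FEq (zv ij.1 ij.2 * zv i j - zv ij.1 j * zv i ij.2)
           | ij <- enum {: 'I_N * 'I_M}])).
have zvE (K : fieldType) (z : 'rV[K]_(N * M)) i j :
    ieval (z ord0) (zv i j) = z ord0 (mxvec_index i j) by rewrite ievalX.
have phiE (K : fieldType) (z : 'rV[K]_(N * M)) i j : feval (z ord0) (phi i j) <->
    (ptK Z z -> z ord0 (mxvec_index i j) != 0 ->
    [/\ ptK X (zcol z j), ptK Y (zrow z i) &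
    forall i' j', z ord0 (mxvec_index i' j') * z ord0 (mxvec_index i j) =
      z ord0 (mxvec_index i' j) * z ord0 (mxvec_index i j')]).
  rewrite !(fevalImp, fevalAnd, feval_pt, fevalNot, fevalAll) vecK_id.
  have -> : vecK (z ord0) (zv^~ j) = zcol z j by apply/rowP => k; rewrite !mxE zvE.
  have -> : vecK (z ord0) (zv i) = zrow z i by apply/rowP => k; rewrite !mxE zvE.
  rewrite [feval _ (FEq _)]/= zvE all_map; split=> [/implyP h Zz z0|h].
    have /andP[/andP[Xz Yz] /allP m] := h (introT andP (conj Zz z0)).
    split=> // i' j'; have := m (i', j'); rewrite mem_enum => /(_ isT) /=.
    by rewrite rmorphB !rmorphM /= !zvE subr_eq0 => /eqP.
  apply/implyP => /andP[Zz z0]; have [-> -> m] := h Zz z0.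
  by apply/allP => -[i' j'] _; rewrite /= rmorphB !rmorphM /= !zvE subr_eq0 m.
have step i j : almost_all (fun K => forall z : 'rV[K]_(N * M), feval (z ord0) (phi i j)).
  apply: transfer_row => z; apply/phiE; rewrite ptKE => /XYZ[x [y [Xx Yy ->]]].
  rewrite -/(segre x y) segreE mulf_eq0 negb_or => /andP[xi yj].
  have -> : zcol (segre x y) j = y ord0 j *: x.
    by apply/rowP => k; rewrite !mxE segreE mulrC.
  have -> : zrow (segre x y) i = x ord0 i *: y.
    by apply/rowP => k; rewrite !mxE segreE.
  rewrite !ptKE !qp_pt_scale //; split=> // i' j'.
  by rewrite !segreE mulrACA [y _ _ * _]mulrC mulrACA.
apply: almost_all_mono (@almost_all_in _ (enum {: 'I_N * 'I_M})
  (fun ij K => forall z : 'rV[K]_(N * M), feval (z ord0) (phi ij.1 ij.2)) _)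
  => [K Kphi z i j|ij _].
  by apply/phiE/(Kphi (i, j)); rewrite mem_enum.
exact: step.
Qed.

(** Every [z] comes from [#|K| - 1] pairs: [x] ranges over the line of a nonzero column of [z], and
    then [x] and [z] determine [y]. Since [#|K| - 1] is -1 in [K], the signs agree. *)
Lemma pcount_prod : almost_all (fun K => pcount K X * pcount K Y = pcount K Z).
Proof.
apply: almost_allI2 (almost_allI2 (fun K a b => conj a b)
  segre_transfer segre_inv_transfer) (almost_allI2 (fun K a b => conj a b)
  (parallel_transfer X) (parallel_transfer Y)).
move=> K [ZXY Zinv] [Xpar Ypar].
suff : (pcard K X * pcard K Y = pcard K Z * #|K|.-1)%N.
  move/(congr1 (fun k : nat => k%:R : K)).
  by rewrite /pcount mulrNN !natrM finField_natr_pred mulrN1.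
pose XY (p : 'rV[K]_N * 'rV[K]_M) := ptK X p.1 && ptK Y p.2.
have -> : (pcard K X * pcard K Y = \sum_(p | XY p) 1)%N.
  by rewrite sum1_card -cardX; apply: eq_card => p; rewrite !inE.
rewrite (partition_big (fun p => segre p.1 p.2) (fun z => ptK Z z)) /=; last first.
  by move=> p /andP[]; apply: ZXY.
rewrite /pcard -sum_nat_const; apply: eq_bigr => z Zz.
have /rV0Pn[k] : z != 0 by case/and3P: Zz.
case/mxvec_indexP: k => i j zij.
have [Xc Yr minors] := Zinv z i j Zz zij.
have c0 : zcol z j != 0 by case/and3P: Xc.
have r0 : zrow z i != 0 by case/and3P: Yr.
rewrite sum1_card -(card_line c0).
pose F (x : 'rV[K]_N) := (x, (x ord0 i)^-1 *: zrow z i).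
have injF : injective F by move=> x x' [].
rewrite -(card_image injF); apply: eq_card => -[x y]; rewrite [LHS]inE /=.
apply/andP/imageP => [[/andP[/= Xx Yy] /eqP def_z]|[x' ]].
  move: zij; rewrite -def_z segreE mulf_eq0 negb_or => /andP[xi yj].
  have x0 : x != 0 by case/and3P: Xx.
  exists x; first rewrite inE x0; last congr pair.
    apply/parallelP; rewrite ?def_z //; exists (y ord0 j)^-1; first by rewrite invr_eq0.
    apply/rowP => k; rewrite !mxE -def_z segreE mulrC mulfK //.
  by apply/rowP => k; rewrite !mxE -def_z segreE mulKf.
rewrite inE => /andP[x'0 par] [-> ->].
have [c cn0 def_x] := parallelP c0 x'0 par.
have xi : x' ord0 i != 0 by rewrite def_x !mxE mulf_neq0.
split.
  rewrite /XY /= (Xpar _ _ Xc x'0 par) /=.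
  have y0 : (x' ord0 i)^-1 *: zrow z i != 0 by rewrite scaler_eq0 invr_eq0 negb_or xi.
  apply: (Ypar _ _ Yr y0); apply/parallelP => //.
  by exists (x' ord0 i)^-1; rewrite ?invr_eq0.
apply/eqP/rowP => k; case/mxvec_indexP: k => i' j'; rewrite segreE !mxE.
apply: (mulIf zij); rewrite minors def_x !mxE invfM [c * _]mulrC -!mulrA.
by rewrite mulVKf // [_ * z _ (mxvec_index i j)]mulrC mulKf.
Qed.

End Product.

(** * Affine varieties *)

Lemma row_mx1_0 (R : Type) n (a : 'rV[R]_1) (x : 'rV[R]_n) :
  (row_mx a x : 'rV_n.+1) ord0 ord0 = a ord0 ord0.
Proof.
have -> : ord0 = (lshift n (ord0 : 'I_1) : 'I_n.+1) by apply/val_inj.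
exact: row_mxEl.
Qed.

Lemma row_mx1_lift (R : Type) n (a : 'rV[R]_1) (x : 'rV[R]_n) i :
  (row_mx a x : 'rV_n.+1) ord0 (lift ord0 i) = x ord0 i.
Proof.
have -> : lift ord0 i = (rshift 1 i : 'I_n.+1) by apply/val_inj.
exact: row_mxEr.
Qed.

Lemma qeval_homogenize n (p : {mpoly rat[n]}) a (x : 'rV[algC]_n) :
  qeval (homogenize p) (row_mx a%:M (a *: x)) = a ^+ (msize p).-1 * qeval p x.
Proof.
have -> : row_mx a%:M (a *: x) = a *: row_mx 1%:M x :> 'rV_(1 + n).
  by rewrite scale_row_mx scale_scalar_mx mulr1.
rewrite (qeval_homog _ _ (homogenize_homog p)); congr (_ * _).
rewrite !qeval_mmap /homogenize rmorph_sum; apply: eq_bigr => m _ /=.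
rewrite mmapZ rmorphM /= rmorphXn /= mmapX mmap1U rmorph_prod /=.
rewrite row_mx1_0 mxE expr1n mul1r; congr (_ * _); apply: eq_bigr => i _.
rewrite rmorphXn /= mmapX mmap1U; congr (_ ^+ _).
exact: row_mx1_lift.
Qed.

Definition affK (K : fieldType) n (F G : seq {mpoly rat[n]}) (x : 'rV[K]_n) :=
  vanishK F x && ~~ vanishK G x.

Lemma qp_pt_affine n (F G : seq {mpoly rat[n]}) a (x : 'rV[algC]_n) :
  qp_pt (affine_var F G) (row_mx a%:M (a *: x)) = (a != 0) && affK F G x.
Proof.
rewrite /qp_pt /vanish /qp_eqs /qp_neqs /= !all_map.
have X0 b (y : 'rV[algC]_n) : qeval 'X_ord0 (row_mx b%:M y : 'rV_(1 + n)) = b.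
  by rewrite qeval_mmap mmapX mmap1U row_mx1_0 mxE.
have [->|a0] := eqVneq a 0.
  have G0 : all (preim (fun g => 'X_ord0 * homogenize g)
      (fun p => qeval p (row_mx 0%:M (0 *: x) : 'rV_(1 + n)) == 0)) G.
    apply/allP => g _ /=.
    by rewrite qeval_mmap rmorphM /= -!qeval_mmap X0 mul0r eqxx.
  by rewrite G0 /= !andbF.
have -> : row_mx a%:M (a *: x) != 0 :> 'rV[algC]_(1 + n).
  apply: contraNneq a0 => /rowP/(_ (lshift n ord0)).
  by rewrite row_mxEl !mxE eqxx mulr1n => ->.
rewrite /affK !vanishKE /vanish; congr (_ && ~~ _); apply: eq_all => f /=.
  by rewrite qeval_homogenize mulf_eq0 expf_eq0 (negPf a0) andbF.
rewrite qeval_mmap rmorphM /= -!qeval_mmap.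
by rewrite X0 qeval_homogenize !mulf_eq0 expf_eq0 (negPf a0) andbF.
Qed.

Lemma affine_transfer n (F G : seq {mpoly rat[n]}) : almost_all (fun K =>
  forall a (x : 'rV[K]_n),
  ptK (affine_var F G) (row_mx a%:M (a *: x) : 'rV_(1 + n)) = (a != 0) && affK F G x).
Proof.
(* The symbolic vector [(a, a x)] in the variables [a] and [x]. *)
pose s (k : 'I_(1 + n)) : {mpoly int[1 + n]} :=
  match split k with inl i => lv n i | inr j => lv n ord0 * rv 1 j end.
pose aff := FAnd (FVanish (@rv 1 n) F) (FNot (FVanish (@rv 1 n) G)).
pose rhs := FAnd (FNot (FEq (lv n ord0))) aff.
pose phi := FAnd (FImp (FPt (affine_var F G) s) rhs) (FImp rhs (FPt (affine_var F G) s)).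
have phiE (K : fieldType) a (x : 'rV[K]_n) : feval (row_mx a%:M x ord0) phi =
    (ptK (affine_var F G) (row_mx a%:M (a *: x) : 'rV_(1 + n)) == (a != 0) && affK F G x).
  rewrite !(fevalAnd, fevalImp, fevalNot, feval_pt, feval_vanish) vecK_r.
  have -> : feval (row_mx a%:M x ord0) (FEq (lv n ord0)) = (a == 0).
    by rewrite /= ievalX row_mxEl mxE.
  have -> : vecK (row_mx a%:M x ord0) s = row_mx a%:M (a *: x).
    apply/rowP => k; rewrite mxE /s mxE; case: (split k) => [i|j] /=.
      by rewrite ievalX row_mxEl.
    by rewrite rmorphM /= !ievalX row_mxEl row_mxEr !mxE.
  by rewrite -/(affK F G x); case: (ptK _ _) (a != 0) (affK F G x) => [] [] [].
apply: almost_all_mono (@transfer_row_mx _ _ phi _) => [K Kphi a x|v x].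
  by apply/eqP; rewrite -phiE.
by rewrite [v]mx11_scalar phiE ptKE qp_pt_affine.
Qed.

(** There are no points at infinity, because ['X_ord0] divides all forms in [qp_neqs]. *)
Lemma affine_inf_transfer n (F G : seq {mpoly rat[n]}) : almost_all (fun K =>
  forall a (x : 'rV[K]_n),
  ptK (affine_var F G) (row_mx a x : 'rV_(1 + n)) -> a ord0 ord0 != 0).
Proof.
pose phi := FImp (FPt (affine_var F G) (@idv (1 + n))) (FNot (FEq (lv n ord0))).
have phiE (K : fieldType) a (x : 'rV[K]_n) : feval (row_mx a x ord0) phi =
    (ptK (affine_var F G) (row_mx a x : 'rV_(1 + n)) ==> (a ord0 ord0 != 0)).
  rewrite !(fevalImp, fevalNot, feval_pt) vecK_id.
  by rewrite [feval _ (FEq _)]/= ievalX row_mxEl.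
apply: almost_all_mono (@transfer_row_mx _ _ phi _) => [K Kphi a x|a x].
  by have := Kphi a x; rewrite phiE => /implyP.
rewrite phiE ptKE; apply/implyP; apply: contraTneq => a0.
rewrite /qp_pt negb_and negbK orbC negb_and negbK.
apply/orP; left; apply/orP; right; rewrite /vanish /qp_neqs /= all_map.
apply/allP => g _ /=; rewrite qeval_mmap rmorphM /= mmapX mmap1U.
by rewrite row_mx1_0 a0 mul0r.
Qed.

(** The cone consists of the vectors [(a, a x)] with [a] nonzero and [x] a solution; the factor
    [#|K| - 1], equal to -1 in [K], cancels the sign in [pcount]. *)
Lemma pcount_affine n (F G : seq {mpoly rat[n]}) : almost_all (fun K =>
  pcount K (affine_var F G) = #|[pred x : 'rV[K]_n | affK F G x]|%:R).
Proof.
apply: almost_allI2 (affine_transfer F G) (affine_inf_transfer F G) => K aff inf.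
suff : (pcard K (affine_var F G) =
    #|K|.-1 * #|[pred x : 'rV[K]_n | affK F G x]|)%N.
  by rewrite /pcount => ->; rewrite natrM finField_natr_pred mulN1r opprK.
rewrite -(cardC1 (0 : K)) -fintype.cardX.
pose f (p : K * 'rV[K]_n) : 'rV[K]_(1 + n) := row_mx p.1%:M (p.1 *: p.2).
rewrite -(card_in_image (f := f)) => [|[a x] [b y]]; last first.
  rewrite !inE /= => /andP[a0 _] _ /eq_row_mx[].
  move/(congr1 (fun m : 'M_1 => m ord0 ord0)); rewrite !mxE !mulr1n /= => <-.
  by move/(scalerI a0) ->.
apply: eq_card => v; rewrite [LHS]inE /=.
apply/idP/imageP => [|[[a x]]]; last first.
  by rewrite !inE /= => /andP[a0 ax] ->; rewrite aff a0.
rewrite -[v](hsubmxK (v : 'rV_(1 + n))) => Xv; have := inf _ _ Xv; move: Xv.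
move: (lsubmx _) (rsubmx _) => l x; rewrite [l]mx11_scalar; move: (l 0 0) => a.
rewrite mxE mulr1n => Xv a0; exists (a, a^-1 *: x); last by rewrite /f /= scalerKV.
by rewrite !inE /= a0; move: Xv; rewrite -{1}[x](scalerKV a0) aff => /andP[].
Qed.

(** * Graph hypersurface complements *)

Section Multiaffine.
Variable R : comNzRingType.

Definition upd n (t : 'rV[R]_n) i x : 'rV[R]_n :=
  \row_j if j == i then x else t ord0 j.

Lemma updE n (t : 'rV[R]_n) i x j :
  upd t i x ord0 j = if j == i then x else t ord0 j.
Proof. by rewrite mxE. Qed.

Definition affine_fun (f : R -> R) := exists a b, forall x, f x = a + x * b.

Definition multiaffine n (F : 'rV[R]_n -> R) :=
  forall i t, affine_fun (fun x => F (upd t i x)).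

(* The coefficient of the product of all variables when F is multiaffine. *)
Fixpoint top_coef n : ('rV[R]_n -> R) -> R :=
  match n with
  | 0 => fun F => F 0
  | n'.+1 => fun F => top_coef (fun t : 'rV[R]_n' =>
      F (row_mx 1%:M t : 'rV_(1 + n')) - F (row_mx 0%:M t : 'rV_(1 + n')))
  end.

Lemma upd_lift n (a : R) (t : 'rV[R]_n) i x :
  (row_mx a%:M (upd t i x) : 'rV_n.+1) =
    upd (row_mx a%:M t : 'rV_n.+1) (lift ord0 i) x.
Proof.
apply/rowP => j; rewrite updE; case: (unliftP ord0 j) => [k|] ->.
  by rewrite !row_mx1_lift updE (inj_eq lift_inj).
by rewrite !row_mx1_0 (negPf (neq_lift _ _)).
Qed.

Lemma upd_ord0 n (a x : R) (t : 'rV[R]_n) :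
  upd (row_mx a%:M t : 'rV_n.+1) ord0 x = row_mx x%:M t.
Proof.
apply/rowP => j; rewrite updE; case: (unliftP ord0 j) => [k|] ->.
  by rewrite eq_sym (negPf (neq_lift _ _)) !row_mx1_lift.
by rewrite eqxx !row_mx1_0 mxE.
Qed.

Lemma multiaffine_diff n (F : 'rV[R]_n.+1 -> R) : multiaffine F ->
  multiaffine (fun t : 'rV[R]_n =>
    F (row_mx 1%:M t : 'rV_(1 + n)) - F (row_mx 0%:M t : 'rV_(1 + n))).
Proof.
move=> maF i t.
have [a [b ab]] := maF (lift ord0 i) (row_mx 1%:M t).
have [c [d cd]] := maF (lift ord0 i) (row_mx 0%:M t).
exists (a - c), (b - d) => x.
by rewrite !upd_lift ab cd mulrBr opprD addrACA.
Qed.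

Lemma affine_funD f g : affine_fun f -> affine_fun g ->
  affine_fun (fun x => f x + g x).
Proof.
move=> [a [b fE]] [c [d gE]]; exists (a + c), (b + d) => x.
by rewrite fE gE mulrDr addrACA.
Qed.

Lemma affine_funM c f : affine_fun f -> affine_fun (fun x => f x * c).
Proof.
by move=> [a [b fE]]; exists (a * c), (b * c) => x; rewrite fE mulrDl mulrA.
Qed.

Lemma affine_fun_sum (I : finType) (P : pred I) (f : I -> R -> R) :
  (forall i, P i -> affine_fun (f i)) -> affine_fun (fun x => \sum_(i | P i) f i x).
Proof.
move=> aff; elim: index_enum => [|i s IH].
  by exists 0, 0 => x; rewrite big_nil mulr0 addr0.
have [Pi|nPi] := boolP (P i); last first.
  by have [a [b ab]] := IH; exists a, b => x; rewrite big_cons (negPf nPi).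
have [a [b ab]] := affine_funD (aff i Pi) IH.
by exists a, b => x; rewrite big_cons Pi ab.
Qed.

End Multiaffine.

Lemma rmorph_top_coef (R S : comNzRingType) (phi : {rmorphism R -> S}) n
    (F : 'rV[R]_n -> R) (G : 'rV[S]_n -> S) :
  (forall t, G (map_mx phi t) = phi (F t)) -> top_coef G = phi (top_coef F).
Proof.
elim: n F G => [|n IH] F G FG /=; first by rewrite -FG map_mx0.
apply: IH => t; rewrite rmorphB -!FG.
have mapE a : map_mx phi (row_mx a%:M t : 'rV_n.+1) =
    row_mx (phi a)%:M (map_mx phi t) :> 'rV_(1 + n).
  by rewrite -map_scalar_mx; apply: map_row_mx.
by rewrite !mapE (rmorph0 phi) (rmorph1 phi).
Qed.

Lemma count_affine (K : finFieldType) (a b : K) :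
  \sum_x (a + x * b != 0)%:R = - (b != 0)%:R :> K.
Proof.
have [->|b0] := eqVneq b 0.
  rewrite (eq_bigr (fun=> (a != 0)%:R)) => [|x _]; last by rewrite mulr0 addr0.
  rewrite sumr_const -[_ *+ #|_|]mulr_natl finField_natr_card mul0r oppr0 //.
pose r : K := - a / b.
rewrite (bigD1 r) //= mulfVK // subrr eqxx add0r.
rewrite (eq_bigr (fun=> 1)) => [|x x_ab]; last first.
  suff -> : a + x * b != 0 by [].
  apply: contraNneq x_ab => /eqP; rewrite addrC addr_eq0 => /eqP xb.
  by rewrite /r -xb mulfK.
rewrite sumr_const -finField_natr_pred; congr (_ *+ _).
by rewrite -(cardC1 r); apply: eq_card => x; rewrite !inE.
Qed.

(** Summing over the first variable leaves minus the indicator of a nonzero slope. The slope is the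
    difference of the values at 1 and 0, again multiaffine in the other variables. *)
Lemma sum_multiaffine (K : finFieldType) n (F : 'rV[K]_n -> K) : multiaffine F ->
  \sum_t (F t != 0)%:R = (-1) ^+ n * (top_coef F != 0)%:R :> K.
Proof.
elim: n F => [|n IH] F maF /=.
  rewrite (bigD1 0) //= big1 ?addr0 ?mul1r // => v.
  by rewrite [v]thinmx0 eqxx.
rewrite exprS -mulrA -IH; last exact: multiaffine_diff.
rewrite mulN1r.
pose f (p : K * 'rV[K]_n) : 'rV[K]_n.+1 := (row_mx p.1%:M p.2 : 'rV_(1 + n)).
have bij_f : bijective f.
  exists (fun v : 'rV[K]_n.+1 =>
    (lsubmx (v : 'rV_(1 + n)) 0 0, rsubmx (v : 'rV_(1 + n)))) => [[a x]|v].
    by rewrite /f /= row_mxKl row_mxKr mxE.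
  by rewrite /f /= -mx11_scalar hsubmxK.
rewrite (reindex f) /=; last exact: onW_bij.
rewrite -(pair_bigA _ (fun a t => (F (f (a, t)) != 0)%:R)) exchange_big /=.
rewrite -sumrN; apply: eq_bigr => t _.
have [a [b ab]] := maF ord0 (row_mx 0%:M t : 'rV_(1 + n)).
have Fab x : F (f (x, t)) = a + x * b by rewrite -ab upd_ord0.
rewrite (eq_bigr (fun x => (a + x * b != 0)%:R)) => [|x _]; last by rewrite Fab.
rewrite count_affine; have := Fab 1; have := Fab 0.
by rewrite /f /= => -> ->; rewrite mul0r mul1r addr0 addrAC subrr add0r.
Qed.

Section Graph.
Variable G : graph.

(** Graph polynomials have integer coefficients, so they can be evaluated over every ring, without
    [zform]. *)
Definition component_eval (R : comNzRingType) (t : 'rV[R]_(nedge G)) C :=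
  \sum_(T : {set 'I_(nedge G)} | spanning_tree C T)
    \prod_(e in edges_of C :\: T) t ord0 e.

Definition graph_eval (R : comNzRingType) (t : 'rV[R]_(nedge G)) :=
  \prod_(C in components G) component_eval t C.

Lemma rmorph_graph_eval (R S : comNzRingType) (phi : {rmorphism R -> S}) t :
  graph_eval (map_mx phi t) = phi (graph_eval t).
Proof.
rewrite rmorph_prod; apply: eq_bigr => C _; rewrite rmorph_sum.
apply: eq_bigr => T _; rewrite rmorph_prod.
by apply: eq_bigr => e _; rewrite mxE.
Qed.

Lemma qeval_graph_poly (v : 'rV[algC]_(nedge G)) :
  qeval (graph_poly G) v = graph_eval v.
Proof.
rewrite qeval_mmap rmorph_prod; apply: eq_bigr => C _.
rewrite rmorph_sum; apply: eq_bigr => T _.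
rewrite rmorph_prod; apply: eq_bigr => e _.
by rewrite /= mmapX mmap1U.
Qed.

Lemma trivIset_components : trivIset (components G).
Proof.
have /and3P[] // : partition (components G) [set: vertex G].
apply: equivalence_partitionP => x y z _ _ _; split=> // xy.
apply: same_connect => //; apply: sym_connect_sym => u w.
by apply/existsP/existsP => -[e eP]; exists e; rewrite orbC.
Qed.

(** The monomials of a component are squarefree, and an edge belongs to at most one component, so at
    most one factor depends on a given variable. *)
Lemma multiaffine_graph_eval (R : comNzRingType) : multiaffine (@graph_eval R).
Proof.
move=> i t.
have cst C : i \notin edges_of C -> forall x y,
    component_eval (upd t i x) C = component_eval (upd t i y) C.
  move=> iC x y; apply: eq_bigr => T _; apply: eq_bigr => e.
  rewrite inE => /andP[_ eC]; rewrite !mxE; case: eqP => // ei.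
  by rewrite -ei eC in iC.
have aff C : affine_fun (fun x => component_eval (upd t i x) C).
  apply: affine_fun_sum => T _.
  have [iS|iS] := boolP (i \in edges_of C :\: T).
    exists 0, (\prod_(e in edges_of C :\: T | e != i) t ord0 e) => x.
    rewrite add0r (bigD1 i) //= mxE eqxx; congr (_ * _).
    by apply: eq_bigr => e /andP[_ ei]; rewrite mxE (negPf ei).
  exists (\prod_(e in edges_of C :\: T) t ord0 e), 0 => x.
  rewrite mulr0 addr0; apply: eq_bigr => e eS; rewrite mxE.
  by case: eqP iS => // <-; rewrite eS.
have [/exists_inP[C0 C0G iC0]|no] :=
    boolP [exists C in components G, i \in edges_of C]; last first.
  exists (graph_eval (upd t i 0)), 0 => x; rewrite mulr0 addr0.
  apply: eq_bigr => C CG; apply: cst; apply: contra no => iC.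
  by apply/exists_inP; exists C.
have [a [b ab]] := affine_funM
  (\prod_(C in components G | C != C0) component_eval (upd t i 0) C) (aff C0).
exists a, b => x; rewrite -ab /graph_eval (bigD1 C0) //=; congr (_ * _).
apply: eq_bigr => C /andP[CG CC0]; apply: cst; apply/negP => iC.
have /trivIsetP/(_ _ _ CG C0G CC0)/pred0P/(_ (ends i).1) := trivIset_components.
by move: iC iC0; rewrite !inE /= => -> ->.
Qed.

End Graph.

(** Over almost all fields, [zform] may be replaced by any explicit integer polynomial with the same
    zeros over [algC]. *)
Lemma zform_transfer n (f : {mpoly rat[n]}) (g : {mpoly int[n]}) :
    (forall v : 'rV[algC]_n, (qeval f v == 0) = (ieval (v ord0) g == 0)) ->
  almost_all (fun K => forall v : 'rV[K]_n,
    (ieval (v ord0) (zform f) == 0) = (ieval (v ord0) g == 0)).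
Proof.
move=> fg; pose phi := FAnd (FImp (FEq (zform f)) (FEq g)) (FImp (FEq g) (FEq (zform f))).
have phiE (K : fieldType) (v : 'rV[K]_n) : feval (v ord0) phi =
    ((ieval (v ord0) (zform f) == 0) == (ieval (v ord0) g == 0)).
  by rewrite fevalAnd !fevalImp /=; case: (ieval _ g == 0) (ieval _ _ == 0) => [] [].
apply: almost_all_mono (@transfer_row _ phi _) => [K Kphi v|v].
  by have := Kphi v; rewrite phiE => /eqP.
by rewrite phiE zform_eq0 fg.
Qed.

Lemma pcount_graph G : exists c : int,
  almost_all (fun K => pcount K (graph_complement G) = c%:~R).
Proof.
pose gX : {mpoly int[nedge G]} := graph_eval (\row_e 'X_e).
have gXE (K : comNzRingType) (v : 'rV[K]_(nedge G)) : ieval (v ord0) gX = graph_eval v.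
  rewrite /gX -(rmorph_graph_eval (ieval (v ord0))); congr graph_eval.
  by apply/rowP => e; rewrite !mxE /= ievalX.
have [|d d0 Kgraph] := @zform_transfer _ (graph_poly G) gX.
  by move=> v; rewrite qeval_graph_poly gXE.
have [d' d'0 Kaff] := pcount_affine [::] [:: graph_poly G].
pose tau := top_coef (@graph_eval G int).
pose c : int := (-1) ^+ nedge G * (tau != 0)%:R.
(* The factor [m] excludes the characteristics dividing a nonzero [tau], so that the image of [tau]
   in [K] vanishes only if [tau] does. *)
exists c; pose m := if tau == 0 then 1 else tau.
exists (d * d' * m) => [|K].
  by rewrite !mulf_neq0 // /m; case: (eqVneq tau 0).
rewrite !rmorphM !mulf_eq0 !negb_or => /andP[/andP[dK d'K] mK].
rewrite Kaff //.
have -> : #|[pred x : 'rV[K]_(nedge G) | affK [::] [:: graph_poly G] x]|%:R =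
    \sum_(t : 'rV[K]_(nedge G)) (graph_eval t != 0)%:R :> K.
  rewrite -sum1_card natr_sum big_mkcond; apply: eq_bigr => t _.
  rewrite inE /affK /vanishK /= andbT Kgraph // gXE.
  by case: (_ == 0).
rewrite sum_multiaffine; last exact: multiaffine_graph_eval.
have -> : top_coef (@graph_eval G K) = tau%:~R.
  by apply: rmorph_top_coef => t; apply: rmorph_graph_eval.
rewrite rmorphXn rmorphN1 /= rmorph_nat; congr (_ * (nat_of_bool _)%:R).
move: mK; rewrite /m; case: (eqVneq tau 0) => [-> _|_ ->] //.
by rewrite eqxx.
Qed.

(** * The span of the graph classes *)

Section RelationValues.
Variables (R : comNzRingType) (K : finFieldType) (phi : {rmorphism R -> K}).

Lemma rmorph_sub0 x y a b : phi x = a -> phi y = b -> a = b -> phi (x - y) = 0.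
Proof. by move=> <- <- e; rewrite rmorphB e subrr. Qed.

Lemma rmorphD_eq x y a b : phi x = a -> phi y = b -> phi (x + y) = a + b.
Proof. by move=> <- <-; rewrite rmorphD. Qed.

Lemma rmorphM_eq x y a b : phi x = a -> phi y = b -> phi (x * y) = a * b.
Proof. by move=> <- <-; rewrite rmorphM. Qed.

End RelationValues.

Lemma mu_subproof (K : finFieldType) : {phi : {rmorphism freeVar -> K} |
  forall N (X : qpvar N), phi (gen X) = pcount K X}.
Proof.
exists (FreeComRingMorphism.extend
  (fun X : {N : nat & qpvar N} => pcount K (tagged X))) => N X.
exact: FreeComRingMorphism.extend_gen.
Qed.

Definition mu (K : finFieldType) : {rmorphism freeVar -> K} := sval (mu_subproof K).

Lemma mu_gen (K : finFieldType) N (X : qpvar N) : mu K (gen X) = pcount K X.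
Proof. exact: svalP (mu_subproof K) N X. Qed.

Lemma pcount_affine_space n :
  almost_all (fun K => pcount K (affine_space n) = #|K|%:R ^+ n).
Proof.
have one : forall v : 'rV[algC]_n, (qeval 1 v == 0) = (ieval (v ord0) 1 == 0).
  by move=> v; rewrite qeval_mmap !rmorph1.
apply: almost_allI2 (@pcount_affine n [::] [:: 1]) (zform_transfer one) => K -> K1.
rewrite -natrX; congr (_ *+ _); rewrite -[n in RHS]mul1n -card_mx.
by apply: eq_card => v; rewrite !inE /affK /= K1 rmorph1 oner_eq0.
Qed.

(** Each relation has its own exceptional characteristics, and a derivation uses finitely many
    relations. *)
Lemma mu_ideal x : ideal_gen KVar_rel x -> almost_all (fun K => mu K x = 0).
Proof.
elim=> [{}x xrel||y z _ Py _ Pz|a y _ Py].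
- case: x / xrel => [N M X Y iso|N X Y U YX UXY|N M X Y Z XYZ|].
  + apply: almost_all_mono (pcount_iso iso) => K.
    exact: rmorph_sub0 (mu_gen K X) (mu_gen K Y).
  + apply: almost_all_mono (pcount_scissor YX UXY) => K.
    exact: rmorph_sub0 (mu_gen K X) (rmorphD_eq (mu_gen K U) (mu_gen K Y)).
  + apply: almost_all_mono (pcount_prod XYZ) => K.
    exact: rmorph_sub0 (rmorphM_eq (mu_gen K X) (mu_gen K Y)) (mu_gen K Z).
  + apply: almost_all_mono (pcount_affine_space 0) => K.
    exact: rmorph_sub0 (mu_gen K _) (rmorph1 (mu K)).
- by apply: almost_allT => K; exact: rmorph0 (mu K).
- apply: almost_allI2 Py Pz => K ey ez.
  by apply: etrans (rmorphD_eq ey ez) _; rewrite addr0.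
- apply: almost_all_mono Py => K ey.
  by apply: etrans (rmorphM_eq erefl ey) _; rewrite mulr0.
Qed.

(** The exceptional characteristics depend on the relation, so [mu K] is used on the free ring and
    the span is lifted there. *)
Definition free_scale (p : {poly int}) (x : freeVar) : freeVar :=
  (\sum_(i < size p) gen (affine_space 1) ^+ i *~ p`_i) * x.

Section GenPiMorphism.
Variables (R : comNzRingType) (P : R -> Prop).

Fact gen_pi_zmod_morphism : zmod_morphism (gen_pi P).
Proof. by move=> x y; rewrite /gen_pi raddfB. Qed.

Fact gen_pi_monoid_morphism : monoid_morphism (gen_pi P).
Proof. by split=> // x y; apply: gen_piM. Qed.

HB.instance Definition _ :=
  GRing.isZmodMorphism.Build R (gen_quot P) (gen_pi P) gen_pi_zmod_morphism.
HB.instance Definition _ :=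
  GRing.isMonoidMorphism.Build R (gen_quot P) (gen_pi P) gen_pi_monoid_morphism.

End GenPiMorphism.

Lemma gen_pi_free_scale p x :
  gen_pi KVar_rel (free_scale p x) = ZL_scale p (gen_pi KVar_rel x).
Proof.
rewrite /free_scale /ZL_scale rmorphM rmorph_sum; congr (_ * _).
by apply: eq_bigr => i _; rewrite /= rmorphMz rmorphXn.
Qed.

Lemma mu_span (s : seq ({poly int} * graph)) : exists c : int,
  almost_all (fun K =>
    mu K (\sum_(a <- s) free_scale a.1 (gen (graph_complement a.2))) = c%:~R).
Proof.
elim: s => [|[p G] s [c IH]].
  by exists 0; apply: almost_allT => K; rewrite big_nil rmorph0.
(* The Lefschetz class is sent to [#|K|], which is 0 in [K], so only the constant coefficient of [p]
   contributes. *)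
have [b bG] := pcount_graph G; exists (p`_0 * b + c).
apply: almost_allI2 (almost_allI2 (fun K e1 e2 => conj e1 e2) IH bG)
  (pcount_affine_space 1) => K [IHK bK] LK.
rewrite big_cons rmorphD /= IHK rmorphD; congr (_ + _).
rewrite /free_scale rmorphM /= mu_gen bK intrM; congr (_ * _).
rewrite rmorph_sum /=.
under eq_bigr do rewrite rmorphMz rmorphXn /= mu_gen LK expr1 finField_natr_card.
case: (polyseq p) => [|a q] /=; first by rewrite big_ord0.
rewrite big_ord_recl /= big1 ?addr0 // => i _.
by rewrite expr0n /= mul0rz.
Qed.

Definition sqrtN1_poly : {mpoly rat[1]} := 'X_ord0 ^+ 2 + 1.

(* The spectrum of Q(i). *)
Definition sqrtN1_var := affine_var [:: sqrtN1_poly] [:: 1].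

Lemma pcount_sqrtN1 : almost_all (fun K => pcount K sqrtN1_var =
  #|[pred v : 'rV[K]_1 | v ord0 ord0 ^+ 2 + 1 == 0]|%:R).
Proof.
have one : forall v : 'rV[algC]_1, (qeval 1 v == 0) = (ieval (v ord0) 1 == 0).
  by move=> v; rewrite qeval_mmap !rmorph1.
have sqr : forall v : 'rV[algC]_1, (qeval sqrtN1_poly v == 0) =
    (ieval (v ord0) ('X_ord0 ^+ 2 + 1) == 0).
  move=> v; rewrite qeval_mmap !rmorphD !rmorphXn !rmorph1 /=.
  by rewrite mmapX mmap1U ievalX.
apply: almost_allI2 (almost_allI2 (fun K e1 e2 => conj e1 e2)
  (zform_transfer one) (zform_transfer sqr))
  (pcount_affine [:: sqrtN1_poly] [:: 1]) => K [K1 Ksqr] ->.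
congr (_ *+ _); apply: eq_card => v; rewrite !inE /affK /= K1 Ksqr.
by rewrite rmorphD rmorphXn !rmorph1 /= ievalX oner_eq0 !andbT.
Qed.

(** * Large primes for which -1 is a square, or is not *)

Lemma Fp_natr_eq0 p (n : nat) : prime p -> (n%:R == 0 :> 'F_p) = (p %| n)%N.
Proof. by move=> p_pr; rewrite (dvdn_pcharf (pchar_Fp p_pr)). Qed.

Lemma Fp_intr_eq0 p (n : int) : prime p -> (n%:~R == 0 :> 'F_p) = (p %| `|n|)%N.
Proof.
move=> p_pr; case: n => n; first exact: Fp_natr_eq0.
by rewrite NegzE rmorphN oppr_eq0 abszN; apply: Fp_natr_eq0.
Qed.

(** All prime factors are odd; dividing out one that is 1 modulo 4 leaves a smaller number that is 3
    modulo 4. *)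
Lemma prime_factor_3mod4 n : (n %% 4 = 3)%N ->
  exists p, [/\ prime p, (p %| n)%N & (p %% 4 = 3)%N].
Proof.
elim/ltn_ind: n => n IH n3.
have n1 : (1 < n)%N by case: n n3 {IH} => [|[]].
have p_pr := pdiv_prime n1; have p_n := pdiv_dvd n.
have [p3|p3] := eqVneq (pdiv n %% 4)%N 3%N; first by exists (pdiv n).
have def_n : n = (n %/ pdiv n * pdiv n)%N by rewrite divnK.
have odd_n : odd n by rewrite (divn_eq n 4) n3 oddD oddM andbF.
have odd_p : odd (pdiv n) by apply: dvdn_odd odd_n.
have p1 : (pdiv n %% 4 = 1)%N.
  move: odd_p p3 (ltn_pmod (pdiv n) (isT : 0 < 4)%N).
  rewrite {1}(divn_eq (pdiv n) 4) oddD oddM andbF /=.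
  by case: (_ %% 4)%N => [|[|[|[|]]]].
have [||q [q_pr q_n q3]] := IH (n %/ pdiv n)%N.
- by rewrite ltn_Pdiv ?prime_gt1 // ltnW.
- by apply: etrans n3; rewrite [in RHS]def_n -modnMmr p1 muln1.
by exists q; split=> //; rewrite def_n dvdn_mulr.
Qed.

Lemma dvdn_fact_lt p m : (0 < p)%N -> ~~ (p %| m`!)%N -> (m < p)%N.
Proof. by move=> p0; apply: contraNltn => pm; apply: dvdn_fact; rewrite p0. Qed.

(** Euclid's argument: [4 * m! - 1] is 3 modulo 4 and has no prime factor up to [m]. *)
Lemma prime_3mod4_gt m : exists p, [/\ prime p, (m < p)%N & (p %% 4 = 3)%N].
Proof.
have fact0 := fact_gt0 m.
have [|p [p_pr p_n p3]] := @prime_factor_3mod4 (4 * m`!).-1.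
  by rewrite -(prednK fact0) mulnS /= addnC mulnC modnMDl.
exists p; split=> //; apply: dvdn_fact_lt (prime_gt0 p_pr) _; apply/negP => pm.
have : (p %| (4 * m`!).-1.+1)%N by rewrite prednK ?muln_gt0 // dvdn_mull.
by rewrite -addn1 dvdn_addr // dvdn1 => /eqP p1; rewrite p1 in p_pr.
Qed.

(** No prime dividing [m!] divides its square plus 1. Modulo the prime found, [m!] is a square root
    of -1. *)
Lemma prime_dvd_sqr1_gt m : exists p, [/\ prime p, (m < p)%N & (p %| m`! ^ 2 + 1)%N].
Proof.
have n1 : (1 < m`! ^ 2 + 1)%N by rewrite addn1 ltnS expn_gt0 fact_gt0.
have p_pr := pdiv_prime n1; exists (pdiv (m`! ^ 2 + 1)); split=> //; last exact: pdiv_dvd.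
apply: dvdn_fact_lt (prime_gt0 p_pr) _; apply/negP => pm.
have := pdiv_dvd (m`! ^ 2 + 1); rewrite dvdn_addr ?dvdn1; last exact: dvdn_exp.
by move/eqP=> p1; rewrite p1 in p_pr.
Qed.

(** If the square of [x] is -1, an exponent that is 3 modulo 4 gives [x ^+ p = - x], so
    [2 x = 0]. *)
Lemma sqrtN1_3mod4 (F : fieldType) (x : F) p :
  x ^+ p = x -> (p %% 4 = 3)%N -> 2%:R != 0 :> F -> x ^+ 2 + 1 != 0.
Proof.
move=> xp p3 two0; apply/negP; rewrite addr_eq0 => /eqP x2.
have def_p : p = (2 * (2 * (p %/ 4) + 1) + 1)%N.
  by rewrite {1}(divn_eq p 4) p3 mulnDr mulnA -addnA mulnC.
have : x + x == 0.
  rewrite -{1}xp def_p exprD exprM x2 exprD exprM sqrrN !expr1n expr1.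
  by rewrite mul1r mulN1r addNr.
rewrite -mulr2n -mulr_natr mulf_eq0 (negPf two0) orbF => /eqP x0.
by move/eqP: x2; rewrite x0 expr0n eq_sym oppr_eq0 oner_eq0.
Qed.

Lemma Fp_sqrtN1_3mod4 p (x : 'F_p) :
  prime p -> (p %% 4 = 3)%N -> x ^+ 2 + 1 != 0.
Proof.
move=> p_pr p3; apply: (@sqrtN1_3mod4 _ _ p) => //.
  by have := expf_card x; rewrite card_Fp.
rewrite Fp_natr_eq0 //; apply/negP => /(dvdn_leq (isT : 0 < 2)%N).
by have := prime_gt1 p_pr; case: p p3 {p_pr x} => [|[|[|p]]].
Qed.

Theorem theorem3p6 : ~ (forall x : KVar, in_graph_span x).
Proof.
move=> /(_ (KVar_class sqrtN1_var))[s span].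
have ideal : ideal_gen KVar_rel (gen sqrtN1_var -
    \sum_(a <- s) free_scale a.1 (gen (graph_complement a.2))).
  apply/asboolP; rewrite -[`[< _ >]]/(_ \in in_ideal KVar_rel); apply/gen_piP.
  rewrite -/(KVar_class _) span rmorph_sum; apply: eq_bigr => a _.
  exact: esym (gen_pi_free_scale _ _).
have [c cP] := mu_span s.
(* Were the class in the span, the number of square roots of -1 in [K] would be one integer [c]
   modulo almost every characteristic. *)
have [d d0 dP] : almost_all (fun K =>
    #|[pred v : 'rV[K]_1 | v ord0 ord0 ^+ 2 + 1 == 0]|%:R = c%:~R :> K).
  apply: almost_allI2 (almost_allI2 (fun K e1 e2 => conj e1 e2) cP (mu_ideal ideal))
    pcount_sqrtN1 => K [cK /eqP].
  by rewrite rmorphB subr_eq0 /= cK mu_gen => /eqP-> ->.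
have dK p : prime p -> (`|d| < p)%N -> d%:~R != 0 :> 'F_p.
  by move=> p_pr dp; rewrite Fp_intr_eq0 // gtnNdvd // absz_gt0.
(* A prime that is 3 modulo 4 allows no root, hence divides [c]; it is chosen larger than the
   absolute value of [c]. *)
have c0 : c = 0.
  have [p [p_pr]] := prime_3mod4_gt (maxn `|d| `|c|).
  rewrite gtn_max => /andP[dp cp] p3.
  have /esym/eqP := dP _ (dK p p_pr dp).
  rewrite [X in _ == X](_ : _ = 0); last first.
    by rewrite eq_card0 // => v; rewrite !inE; apply/negbTE/Fp_sqrtN1_3mod4.
  rewrite Fp_intr_eq0 // => pc; apply/eqP; rewrite -absz_eq0; apply: contraTT pc => c0.
  by rewrite gtnNdvd // lt0n.
have [p [p_pr dp p_dvd]] := prime_dvd_sqr1_gt `|d|.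
have /eqP := dP _ (dK p p_pr dp); rewrite c0 Fp_natr_eq0 //; apply/negP.
(* The number of roots is positive, as the factorial of [|d|] is a root, and less than [p], as 0 is
   not; so [p] cannot divide it. *)
rewrite gtnNdvd //.
  apply/card_gt0P; exists (\row__ (`|d|`!)%:R).
  by rewrite inE mxE -natrX natr1 -addn1 Fp_natr_eq0.
rewrite -[ltnRHS](card_Fp p_pr) -[ltnRHS]expn1 -[ltnRHS](card_mx _ 1 1).
apply: proper_card; apply/properP; split; first by apply/subsetP.
by exists 0; rewrite // !inE mxE expr0n add0r oner_eq0.
Qed.
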